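(* Let $(\mathbb T_n)_{n\in\mathbb N_0}$ be a refining sequence of partitions of $[0,1]$ with $\mathbb T_0=\{0,1\}$ such that exactly one new partition point is added between any two neighboring points of $\mathbb T_n$ when passing from $\mathbb T_n$ to $\mathbb T_{n+1}$. Let $x\in C[0,1]$ be nonconstant. Suppose that the generalized Faber--Schauder coefficients of $x$ with respect to $(\mathbb T_n)$ satisfy the reverse Jensen condition and that the partition sequence $(\mathbb T_n)_{n\in\mathbb N_0}$ is well-balanced. Then $x$ admits the roughness exponent $R$ with respect to $(\mathbb T_n)_{n\in\mathbb N_0}$ if and only if the finite limit $r:=\lim_n\widehat R_n(x)$ exists, and in that case $R=r$.
   Context: A partition of $[0,1]$ is a finite set $\{t_0,\dots,t_m\}$ with $0=t_0<\dots<t_m=1$; its mesh is the maximal distance between neighboring points. A sequence $(\mathbb T_n)_{n\in\mathbb N_0}$ of partitions is refining if $\mathbb T_0\subset\mathbb T_1\subset\cdots$ and the mesh of $\mathbb T_n$ tends to $0$. Under the assumption above we write $\mathbb T_n=\{t^n_0,\dots,t^n_{2^n}\}$ in increasing order, so that $t^n_k=t^{n+1}_{2k}$. A function $\varrho$ is subexponential if $\frac1t\log\varrho(t)\to0$ as $t\uparrow\infty$. With $\overline\pi_n:=\sup_k|t^n_{k+1}-t^n_k|$ and $\underline\pi_n:=\inf_k|t^n_{k+1}-t^n_k|$, the sequence $(\mathbb T_n)$ is well-balanced if there is a non-decreasing subexponential function $\kappa$ with $\sup_{k\le n}\overline\pi_k/\underline\pi_k\le\kappa(n)$ for all $n\in\mathbb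 N_0$. The generalized Faber--Schauder coefficients of $x\in C[0,1]$ are $$\theta_{n,k}:=x(t^{n+1}_{2k+1})-\frac{t^{n+1}_{2k+2}-t^{n+1}_{2k+1}}{t^{n+1}_{2k+2}-t^{n+1}_{2k}}x(t^{n+1}_{2k})-\frac{t^{n+1}_{2k+1}-t^{n+1}_{2k}}{t^{n+1}_{2k+2}-t^{n+1}_{2k}}x(t^{n+1}_{2k+2}),\qquad n\in\mathbb N_0,\ 0\le k\le 2^n-1.$$ Let $\langle x\rangle_n^{(p)}:=\sum_{k=0}^{2^n-1}|x(t^n_{k+1})-x(t^n_k)|^p$ for $p>0$. The function $x$ admits the roughness exponent $R=1/q$ (with $1/\infty:=0$) with respect to $(\mathbb T_n)$ if there is $q\in[1,\infty]$ such that $\lim_n\langle x\rangle_n^{(p)}=0$ for $p>q$ and $\lim_n\langle x\rangle_n^{(p)}=\infty$ for $p<q$. For $n\in\mathbb N$ set $s_n:=\sqrt{\sum_{m=0}^{n-1}\sum_{k=0}^{2^m-1}2^m\theta_{m,k}^2}$ and $\widehat R_n(x):=1-\frac1n\log_2 s_n$. Reverse Jensen condition: let $\mathbb E$ be expectation with respect to Lebesgue measure on $[0,1]$ and define on $[0,1]$, for $n\in\mathbb N_0$, $$V_n:=\sum_{k=0}^{2^n-1}\Big(\frac{1}{t^{n+1}_{2k+1}-t^{n+1}_{2k}}\mathbf 1_{[t^{n+1}_{2k},t^{n+1}_{2k+1})}-\frac1{t^{n+1}_{2k+2}-t^{n+1}_{2k+1}}\mathbf 1_{[t^{n+1}_{2k+1},t^{n+1}_{2k+2})}\Big),\qquad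 \vartheta_n:=\sum_{k=0}^{2^n-1}\theta_{n,k}\mathbf 1_{[t^n_k,t^n_{k+1})}.$$ The coefficients $(\theta_{m,k})$ satisfy the reverse Jensen condition if for each $p\ge1$ there exists a non-decreasing subexponential function $\varrho_p:\mathbb N\to[1,\infty)$ such that for all $n\in\mathbb N$, $$\frac1{\varrho_p(n)}\Big(\mathbb E\Big[\sum_{m=0}^{n-1}V_m^2\vartheta_m^2\Big]\Big)^{p/2}\le\mathbb E\Big[\Big(\sum_{m=0}^{n-1}V_m^2\vartheta_m^2\Big)^{p/2}\Big]\le\varrho_p(n)\Big(\mathbb E\Big[\sum_{m=0}^{n-1}V_m^2\vartheta_m^2\Big]\Big)^{p/2}.$$
   Formalization: When s_n = 0 (for all n exactly when x is affine), log_2 s_n is read as 0, so R̂_n = 1; with log_2 0 = −∞ or undefined the claim fails for x(t) = t on dyadic partitions, where R = 1 but no finite limit r exists. *)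

(* Defs.v *)
From HB Require Import structures.
From mathcomp Require Import all_boot all_order all_algebra.
From mathcomp Require Import all_classical all_reals all_analysis.
Set Implicit Arguments.
Unset Strict Implicit.
Unset Printing Implicit Defensive.
Import Order.TTheory GRing.Theory Num.Theory.
Import numFieldNormedType.Exports.
Local Open Scope classical_set_scope.
Local Open Scope ring_scope.

Section Partitions.
Variable R : realType.

(* A finite set of reals is given by its strictly increasing enumeration. *)
Definition is_partition (s : seq R) : Prop :=
  [/\ sorted <%R s, s`_0 = 0 & last 0 s = 1].

Definition gaps (s : seq R) : set R :=
  [set `|s`_k.+1 - s`_k| | k in [set k | (k.+1 < size s)%N]].

Definition mesh (s : seq R) : R := sup (gaps s).
Definition min_gap (s : seq R) : R := inf (gaps s).

Definition refining (T : nat -> seq R) : Prop :=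
  [/\ forall n, is_partition (T n),
      forall n, {subset T n <= T n.+1}
    & mesh (T n) @[n --> \oo] --> 0].

Definition one_new_point (T : nat -> seq R) : Prop :=
  forall n k, (k.+1 < size (T n))%N ->
    exists! u : R, [/\ u \in T n.+1, (T n)`_k < u & u < (T n)`_k.+1].

(* Since ln is total on R with ln y = 0 for y <= 0, this notion is only
   meaningful for eventually positive sequences; below, positivity of kappa
   follows from the bound on the mesh ratios, and rho is at least 1. *)
Definition subexponential (u : nat -> R) : Prop :=
  n%:R^-1 * ln (u n) @[n --> \oo] --> (0 : R).

Definition well_balanced (T : nat -> seq R) : Prop :=
  exists kappa : nat -> R,
    [/\ forall m n, (m <= n)%N -> kappa m <= kappa n,
        subexponential kappa
      & forall n, sup [set mesh (T k) / min_gap (T k) | k in [set k | (k <= n)%N]]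
                    <= kappa n].

End Partitions.

Section Roughness.
Variables (R : realType) (T : nat -> seq R).

Definition faber_schauder (x : R -> R) (n k : nat) : R :=
  let a := (T n.+1)`_(2 * k) in
  let b := (T n.+1)`_(2 * k + 1) in
  let c := (T n.+1)`_(2 * k + 2) in
  x b - (c - b) / (c - a) * x a - (b - a) / (c - a) * x c.

Definition p_variation (x : R -> R) (p : R) (n : nat) : R :=
  \sum_(0 <= k < 2 ^ n) `|x (T n)`_k.+1 - x (T n)`_k| `^ p.

(* The inverse is that of \bar R, for which +oo^-1 = 0. *)
Definition roughness_exponent (x : R -> R) (r : R) : Prop :=
  exists q : \bar R,
    [/\ (1 <= q)%E,
        r%:E = (q^-1)%E,
        forall p : R, 0 < p -> (q < p%:E)%E ->
          p_variation x p n @[n --> \oo] --> 0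
      & forall p : R, 0 < p -> (p%:E < q)%E ->
          p_variation x p n @[n --> \oo] --> +oo].

Definition s_ (theta : nat -> nat -> R) (n : nat) : R :=
  Num.sqrt (\sum_(0 <= m < n) \sum_(0 <= k < 2 ^ m) 2 ^+ m * theta m k ^+ 2).

(* s_n vanishes for every n exactly when x is affine; then log_2 s_n is read
   with the convention ln 0 = 0, which gives Rhat_n = 1, the roughness exponent
   of a nonconstant affine function.  For every other continuous x, s_n is
   eventually positive, so the convention does not affect the limit. *)
Definition Rhat (x : R -> R) (n : nat) : R :=
  1 - n%:R^-1 * (ln (s_ (faber_schauder x) n) / ln 2).

Definition V_ (n : nat) (t : R) : R :=
  \sum_(0 <= k < 2 ^ n)
    let a := (T n.+1)`_(2 * k) in
    let b := (T n.+1)`_(2 * k + 1) in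
    let c := (T n.+1)`_(2 * k + 2) in
    ((b - a)^-1 * \1_(`[a, b[%classic) t - (c - b)^-1 * \1_(`[b, c[%classic) t).

Definition vartheta_ (theta : nat -> nat -> R) (n : nat) (t : R) : R :=
  \sum_(0 <= k < 2 ^ n) theta n k * \1_(`[(T n)`_k, (T n)`_k.+1[%classic) t.

Definition square_fun (theta : nat -> nat -> R) (n : nat) (t : R) : R :=
  \sum_(0 <= m < n) V_ m t ^+ 2 * vartheta_ theta m t ^+ 2.

Definition expect (f : R -> R) : R :=
  \int[lebesgue_measure]_(t in `[0, 1]) f t.

Definition reverse_jensen (theta : nat -> nat -> R) : Prop :=
  forall p : R, 1 <= p ->
  exists rho : nat -> R,
    [/\ forall n, (0 < n)%N -> 1 <= rho n,
        forall m n, (0 < m)%N -> (m <= n)%N -> rho m <= rho n,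
        subexponential rho
      & forall n, (0 < n)%N ->
          let A := expect (square_fun theta n) `^ (p / 2) in
          let B := expect (fun t => square_fun theta n t `^ (p / 2)) in
          (rho n)^-1 * A <= B /\ B <= rho n * A].

End Roughness.

(* Main.v *)
Require Import Defs.
From HB Require Import structures.
From mathcomp Require Import all_boot all_order all_algebra.
From mathcomp Require Import all_classical all_reals all_analysis measurable_realfun.
From mathcomp Require Import zify ring lra.
Set Implicit Arguments.
Unset Strict Implicit.
Unset Printing Implicit Defensive.
Import Order.TTheory GRing.Theory Num.Theory.
Import numFieldNormedType.Exports.
Local Open Scope classical_set_scope.
Local Open Scope ring_scope.

(** The slopes of the piecewise linear interpolants of x along the partitions
    form a martingale M on [0, 1]: refining the partition from level n to level
    n + 1 adds the increment D_n = V_n * vartheta_n, so that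
    M_n = M_0 + sum_(m < n) D_m with M_0 = x 1 - x 0 ([slope_process_cell]), and
    the sum of the D_m ^+ 2 is the square function of the reverse Jensen
    condition. The proof shows that for p >= 1, up to subexponential factors,

      p-variation_n = 2^(-n (p - 1)) * E |M_n|^p
                    = 2^(-n (p - 1)) * (|M_0| + s_n)^p.

    The first relation holds because all gaps of level n are comparable to 2^-n
    in a well-balanced sequence ([p_variation_slope_moment]). For the second,
    the Burkholder inequality is replaced by elementary bounds that lose a
    polynomial factor in n, which is subexponential: pointwise, |D_m| is at most
    the root of the square function ([norm_slope_process_le]), and this root is
    at most sum_m |D_m|, hence at most twice the sum of the |M_m|
    ([sqrt_square_fun_le]); the moments E |M_m|^p increase with m by Jensen's
    inequality ([slope_moment_le]). The reverse Jensen condition then exchanges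
    the p/2-th moment of the square function for a power of its expectation,
    which is comparable to s_n ^+ 2 ([expect_square_fun_bounds]).

    Taking logarithms ([ln_p_variation_Rhat]),

      (1/n) log_2 (p-variation_n) = 1 - p * Rhat_n + o(1)    for p >= 1,

    so that, when Rhat_n tends to r, the p-variation vanishes for p > 1/r and
    explodes for 1 <= p < 1/r. Conversely the behaviour of the p-variation for
    p on both sides of q squeezes Rhat_n around 1/q. For p = 1 the variation is
    nondecreasing in n and at most of order 2^n, which confines the limit points
    of Rhat_n to [0, 1]. For p < 1 the p-variation of a nonconstant continuous
    function always explodes ([p_variation_lt1_cvgy]). *)

(** * Partition points *)

Section Interleaving.
Variable R : realType.

Lemma sorted_nth_lt (s : seq R) (i j : nat) :
  sorted <%R s -> (i < j)%N -> (j < size s)%N -> s`_i < s`_j.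
Proof.
move=> ss ij js; apply: (sorted_ltn_nth lt_trans) => //.
by rewrite inE (ltn_trans ij).
Qed.

(** A strictly sorted sequence is determined by its set of entries, so that the
    finer partition must be the interleaving of the coarser one with the new
    points. *)
Lemma interleaved_nth (s s' : seq R) (N : nat) :
  sorted <%R s -> sorted <%R s' -> size s = N.+1 -> (0 < size s')%N ->
  s'`_0 = s`_0 -> last 0 s' = last 0 s -> {subset s <= s'} ->
  (forall k, (k.+1 < size s)%N ->
    exists! u : R, [/\ u \in s', s`_k < u & u < s`_k.+1]) ->
  size s' = (2 * N).+1 /\ forall k, (k <= N)%N -> s'`_(2 * k) = s`_k.
Proof.
move=> ss ss' sN s'0 e0 el sub new.
have /boolp.choice[u uP] : forall k, exists v, (k < N)%N ->
    [/\ v \in s', s`_k < v, v < s`_k.+1 &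
      forall w, [/\ w \in s', s`_k < w & w < s`_k.+1] -> v = w].
  move=> k; case: (ltnP k N) => kN; last by exists 0.
  have /new[v [[v1 v2 v3] v4]] : (k.+1 < size s)%N by rewrite sN.
  by exists v.
pose z j := if odd j then u j./2 else s`_(j./2).
suff -> : s' = mkseq z (2 * N).+1.
  rewrite size_mkseq; split=> // k kN.
  rewrite nth_mkseq; last by lia.
  by rewrite /z mul2n odd_double doubleK.
apply: lt_sorted_eq => //.
  apply/(sortedP 0) => i; rewrite size_mkseq => iN.
  rewrite !nth_mkseq; try lia.
  rewrite /z /= uphalf_half; have := odd_double_half i; case: (odd i) => /= hi.
    have /uP[_ _ ] : (i./2 < N)%N by lia.
    by rewrite add1n.
  by have /uP[_ ] : (i./2 < N)%N by lia.
move=> y; apply/idP/idP => [ys'|].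
  (* locate y between consecutive points of s, to identify it as old or new *)
  have yN : y <= s`_N.
    have -> : s`_N = last 0 s by rewrite -nth_last sN.
    rewrite -el -nth_last -(nth_index 0 ys').
    have : (index y s' <= (size s').-1)%N by rewrite -ltnS prednK // index_mem.
    rewrite leq_eqVlt => /predU1P[->//|h]; apply/ltW/sorted_nth_lt => //.
    by rewrite ltn_predL.
  have y0 : s`_0 <= y.
    rewrite -e0 -(nth_index 0 ys').
    case: (posnP (index y s')) => [->//|h]; apply/ltW/sorted_nth_lt => //.
    by rewrite index_mem.
  have ex : exists k, (k <= N)%N && (s`_k <= y) by exists 0%N.
  have ub k : (k <= N)%N && (s`_k <= y) -> (k <= N)%N by case/andP.
  case: (ex_maxnP ex ub) => k /andP[kN ky] kmax.
  case: (eqVneq s`_k y) => [ey|ney].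
    apply/mapP; exists (2 * k)%N; first by rewrite mem_iota; lia.
    by rewrite /z mul2n odd_double doubleK.
  have {ky} ky : s`_k < y by rewrite lt_neqAle ney.
  have kN' : (k < N)%N.
    rewrite ltn_neqAle kN andbT; apply/eqP => ekN.
    by move: (lt_le_trans ky yN); rewrite ekN ltxx.
  have yk : y < s`_k.+1.
    rewrite ltNge; apply/negP => h.
    by have := kmax k.+1; rewrite kN' h => /(_ isT); rewrite ltnn.
  have [_ _ _ /(_ y) <- //] := uP _ kN'.
  apply/mapP; exists (k.*2.+1)%N; first by rewrite mem_iota; lia.
  by rewrite /z /= odd_double /= uphalf_double.
move=> /mapP[j]; rewrite mem_iota => jN ->; rewrite /z.
have := odd_double_half j; case: (odd j) => hj.
  by have /uP[] : (j./2 < N)%N by lia.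
apply/sub/mem_nth; rewrite sN; lia.
Qed.

End Interleaving.

(** The three standing assumptions on the partitions: they yield 2^n cells at
    level n, the k-th of which splits into the cells 2k and 2k + 1 of level
    n + 1. *)
Definition dyadic_refinement (R : realType) (T : nat -> seq R) : Prop :=
  [/\ refining T, T 0%N = [:: 0; 1] & one_new_point T].

Definition gap (R : realType) (T : nat -> seq R) (n k : nat) : R :=
  (T n)`_k.+1 - (T n)`_k.

Definition cell (R : realType) (T : nat -> seq R) (n k : nat) (t : R) : bool :=
  (T n)`_k <= t < (T n)`_k.+1.

Section Refinement.
Variables (R : realType) (T : nat -> seq R).
Hypothesis T_dyadic : dyadic_refinement T.

Lemma size_partition n : size (T n) = (2 ^ n).+1.
Proof.
have [[Tp Tsub _] T_init T_new] := T_dyadic.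
elim: n => [|n IH]; first by rewrite T_init.
have [ss e0 el] := Tp n; have [ss' e0' el'] := Tp n.+1.
have s'0 : (0 < size (T n.+1))%N.
  by case: (T n.+1) el' => //= /esym/eqP; rewrite oner_eq0.
have [-> _] := @interleaved_nth R _ _ _ ss ss' IH s'0 (etrans e0' (esym e0))
  (etrans el' (esym el)) (Tsub n) (@T_new n).
by rewrite expnS.
Qed.

Lemma partition_even n k : (k <= 2 ^ n)%N -> (T n.+1)`_(2 * k) = (T n)`_k.
Proof.
have [[Tp Tsub _] _ T_new] := T_dyadic.
have [ss e0 el] := Tp n; have [ss' e0' el'] := Tp n.+1.
have s'0 : (0 < size (T n.+1))%N by rewrite size_partition.
have [_ ] := @interleaved_nth R _ _ _ ss ss' (size_partition n) s'0
  (etrans e0' (esym e0)) (etrans el' (esym el)) (Tsub n) (@T_new n).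
exact.
Qed.

Lemma partition_lt n i j : (i < j)%N -> (j <= 2 ^ n)%N -> (T n)`_i < (T n)`_j.
Proof.
have [[Tp _ _] _ _] := T_dyadic; have [ss _ _] := Tp n.
by move=> ij jn; apply: sorted_nth_lt => //; rewrite size_partition.
Qed.

Lemma partition_le n i j : (i <= j)%N -> (j <= 2 ^ n)%N -> (T n)`_i <= (T n)`_j.
Proof.
rewrite leq_eqVlt => /predU1P[->//|ij jn]; exact/ltW/partition_lt.
Qed.

Lemma partition_first n : (T n)`_0 = 0.
Proof. by have [[Tp _ _] _ _] := T_dyadic; case: (Tp n). Qed.

Lemma partition_last n : (T n)`_(2 ^ n) = 1.
Proof.
have [[Tp _ _] _ _] := T_dyadic; case: (Tp n) => _ _ <-.
by rewrite -nth_last size_partition.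
Qed.

Lemma partition_itv01 n k : (k <= 2 ^ n)%N -> 0 <= (T n)`_k <= 1.
Proof.
move=> kn; rewrite -{1}(partition_first n) -(partition_last n).
by rewrite !partition_le.
Qed.

Lemma gap_gt0 n k : (k < 2 ^ n)%N -> 0 < gap T n k.
Proof. by move=> kn; rewrite subr_gt0 partition_lt. Qed.

Lemma cell_left n k : (k < 2 ^ n)%N -> cell T n k (T n)`_k.
Proof. by move=> kn; rewrite /cell lexx partition_lt. Qed.

Lemma cell_inj n j k t : (j < 2 ^ n)%N -> (k < 2 ^ n)%N ->
  cell T n j t -> cell T n k t -> j = k.
Proof.
wlog : j k / (j < k)%N => [hw jn kn jt kt|jk jn kn].
  case: (ltngtP j k) => // h; first exact: hw.
  by apply/esym; apply: hw.
rewrite /cell => /andP[_ tj] /andP[kt _].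
have : (T n)`_j.+1 <= (T n)`_k by apply: partition_le => //; apply: ltnW.
by move=> /(lt_le_trans tj)/lt_le_trans/(_ kt); rewrite ltxx.
Qed.

Lemma cell_half n j t : (j < 2 ^ n.+1)%N -> cell T n.+1 j t -> cell T n j./2 t.
Proof.
rewrite /cell => jn /andP[jt tj].
have e := odd_double_half j; have n2 : (2 ^ n.+1 = 2 * 2 ^ n)%N by rewrite expnS.
have kn : (j./2 < 2 ^ n)%N by lia.
rewrite -(partition_even (ltnW kn)) -(partition_even kn); apply/andP; split.
  by apply: le_trans jt; apply: partition_le; lia.
by apply: lt_le_trans tj _; apply: partition_le; lia.
Qed.

Lemma sum_gap n k : (k <= 2 ^ n)%N -> \sum_(0 <= j < k) gap T n j = (T n)`_k.
Proof.
by move=> kn; rewrite telescope_sumr // partition_first subr0.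
Qed.

End Refinement.

(** * Continuous functions on the unit interval *)

Section UniformContinuity.
Variables (R : realType) (x : R -> R).
Hypothesis x_cont : {within `[0, 1], continuous x}.

(** Heine's theorem, from the near-covering form of compactness: a radius that
    works near each point works eventually for the whole interval. *)
Lemma unit_interval_uniform_continuity (e : R) : 0 < e ->
  exists2 d : R, 0 < d & forall s t : R, 0 <= s <= 1 -> 0 <= t <= 1 ->
    `|s - t| < d -> `|x s - x t| < e.
Proof.
move=> e0.
have /compact_near_coveringP nc := @segment_compact R 0 1.
have := nc R (0 : R)^'+ (fun d s => forall t : R, 0 <= t <= 1 ->
  0 <= s <= 1 -> `|s - t| < d -> `|x s - x t| < e) _.
have h : forall s0 : R, `[0, 1]%classic s0 ->
    \forall s \near s0 & d \near (0:R)^'+, forall t : R, 0 <= t <= 1 -> 0 <= s <= 1 ->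
     `|s - t| < d -> `|x s - x t| < e.
  move=> s0 s01.
  have e2 : 0 < e / 2 by rewrite divr_gt0.
  have : \forall s \near within `[0, 1]%classic (nbhs s0), `|x s0 - x s| < e / 2.
    rewrite nbhs_subspace_in //.
    by have /cvgrPdist_lt := @x_cont s0; exact.
  rewrite /within /= => /nbhs_ballP[d /= d0 dP].
  have d2 : 0 < d / 2 by rewrite divr_gt0.
  exists (ball s0 (d / 2), [set z | z < d / 2]) => /=.
    split; first exact: nbhsx_ballx.
    exact: nbhs_right_lt.
  move=> [s z] /= [] sb zd t t01 s01' st.
  have h1 : `|x s0 - x s| < e / 2.
    apply: dP; last by rewrite /= in_itv.
    by apply: lt_le_trans sb _; lra.
  have h2 : `|x s0 - x t| < e / 2.
    apply: dP; last by rewrite /= in_itv.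
    rewrite /ball /= in sb *.
    have -> : s0 - t = (s0 - s) + (s - t) by ring.
    apply: le_lt_trans (ler_normD _ _) _; lra.
  have -> : x s - x t = (x s0 - x t) - (x s0 - x s) by ring.
  apply: le_lt_trans (ler_normB _ _) _; lra.
move=> /(_ _ h) H.
have : \forall d \near (0:R)^'+, 0 < d /\ `[0, 1] `<=` (fun s => forall t : R, 0 <= t <= 1 ->
  0 <= s <= 1 -> `|s - t| < d -> `|x s - x t| < e).
  near=> d; split; first by near: d; exact: nbhs_right_gt.
  by near: d; exact: H.
move=> /filter_ex [d [d0 dP]]; exists d => // s t s01 t01 st.
by apply: dP => //=; rewrite in_itv.
Unshelve. all: by end_near.
Qed.

(** Bounding the oscillation by the difference of the extreme values avoids any
    bound on x itself. *)
Lemma unit_interval_bounded : exists2 C : R, 0 < C &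
  forall s t : R, 0 <= s <= 1 -> 0 <= t <= 1 -> `|x s - x t| <= C.
Proof.
have [c _ cP] := EVT_max ler01 x_cont.
have [d _ dP] := EVT_min ler01 x_cont.
exists (`|x c - x d| + 1); first by rewrite ltr_pwDr.
move=> s t s01 t01.
have := cP s; have := dP s; have := cP t; have := dP t.
rewrite !in_itv /= => /(_ t01) a1 /(_ t01) a2 /(_ s01) a3 /(_ s01) a4.
have := ler_norm (x c - x d).
rewrite ler_norml => h; apply/andP; split; lra.
Qed.

End UniformContinuity.

(** * Expectations of step functions *)

Lemma sum_pairs (V : nmodType) (F : nat -> V) N :
  \sum_(0 <= j < 2 * N) F j = \sum_(0 <= k < N) (F (2 * k)%N + F (2 * k + 1)%N).
Proof.
elim: N => [|N IH]; first by rewrite muln0 !big_geq.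
by rewrite mulnS !addSn add0n !big_nat_recr //= IH addrA addn1.
Qed.

Section StepFunctions.
Variables (R : realType) (T : nat -> seq R).
Hypothesis T_dyadic : dyadic_refinement T.

Definition step (n : nat) (f : R -> R) : Prop :=
  forall k t, (k < 2 ^ n)%N -> cell T n k t -> f t = f (T n)`_k.

(** The expectation of a function that is constant on the cells of level n; see
    [expect_step]. *)
Definition mean (n : nat) (f : R -> R) : R :=
  \sum_(0 <= k < 2 ^ n) gap T n k * f (T n)`_k.

Lemma step_le m n f : (m <= n)%N -> step m f -> step n f.
Proof.
move=> mn fm; elim: n mn => [|n IH]; first by rewrite leqn0 => /eqP <-.
rewrite leq_eqVlt => /predU1P[<-//|/IH {}IH] k t kn tk.
have e := odd_double_half k; have n2 : (2 ^ n.+1 = 2 * 2 ^ n)%N by rewrite expnS.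
have kn' : (k./2 < 2 ^ n)%N by lia.
rewrite (IH k./2) //; last exact: cell_half.
by rewrite [RHS](IH k./2) //; apply: cell_half => //; exact: cell_left.
Qed.

Lemma mean_le n f g : (forall t, f t <= g t) -> mean n f <= mean n g.
Proof.
move=> fg; rewrite /mean !big_nat; apply: ler_sum => k /andP[_ kn].
by rewrite ler_wpM2l // ltW // gap_gt0.
Qed.

Lemma mean_ge0 n f : (forall t, 0 <= f t) -> 0 <= mean n f.
Proof.
move=> f0; rewrite /mean big_nat sumr_ge0 // => k /andP[_ kn].
by rewrite mulr_ge0 // ltW // gap_gt0.
Qed.

Lemma meanD n f g : mean n (fun t => f t + g t) = mean n f + mean n g.
Proof. by rewrite /mean -big_split; apply: eq_bigr => k _; rewrite mulrDr. Qed.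

Lemma meanZ n c f : mean n (fun t => c * f t) = c * mean n f.
Proof. by rewrite /mean mulr_sumr; apply: eq_bigr => k _; rewrite mulrCA. Qed.

Lemma mean_cst n c : mean n (fun=> c) = c.
Proof.
by rewrite /mean -mulr_suml sum_gap // partition_last // mul1r.
Qed.

Lemma mean_sum n m (F : nat -> R -> R) :
  mean n (fun t => \sum_(0 <= i < m) F i t) = \sum_(0 <= i < m) mean n (F i).
Proof.
rewrite /mean exchange_big; apply: eq_bigr => k _.
by rewrite mulr_sumr.
Qed.

(** Since a step function of level m is also one of level n for m <= n, evaluating
    the same integral at both levels gives [mean T m f = mean T n f]. *)
Lemma expect_step n f : step n f -> expect f = mean n f.
Proof.
move=> fn; rewrite /expect /Rintegral.
pose mu := @lebesgue_measure R.
have mcell k : (k < 2 ^ n)%N ->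
    measurable_fun `[(T n)`_k, (T n)`_k.+1[%classic f /\
    (\int[mu]_(t in `[(T n)`_k, (T n)`_k.+1[%classic) (f t)%:E
      = (gap T n k * f (T n)`_k)%:E)%E.
  move=> kn; have kl := partition_lt T_dyadic (ltnSn k) kn.
  have e : {in `[(T n)`_k, (T n)`_k.+1[%classic,
      cst (f (T n)`_k) =1 f}.
    by move=> t; rewrite inE /= in_itv /= => tk; rewrite (fn k t).
  split; first exact: eq_measurable_fun e (measurable_cst _).
  rewrite (eq_integral (fun=> (f (T n)`_k)%:E)) ?integral_cst //=; last by move=> t /e <-.
  rewrite lebesgue_measure_itv /= lte_fin kl.
  by rewrite -EFinB -EFinM mulrC.
have H k : (k <= 2 ^ n)%N ->
    measurable_fun `[0, (T n)`_k[%classic f /\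
    (\int[mu]_(t in `[0%R, (T n)`_k[%classic) (f t)%:E
      = (\sum_(0 <= j < k) (gap T n j * f (T n)`_j)%R)%:E)%E.
  elim: k => [_|k IH kn].
    rewrite (partition_first T_dyadic) set_itvco0 integral_set0 big_geq //; split => //.
    exact: measurable_fun_set0.
  have [mf If] := IH (ltnW kn); have [mg Ig] := mcell _ kn.
  have k0 : 0 <= (T n)`_k by have /andP[] := partition_itv01 T_dyadic (ltnW kn).
  have kl := partition_lt T_dyadic (ltnSn k) kn.
  have U : `[0, (T n)`_k.+1[%classic =
      `[0, (T n)`_k[%classic `|` `[(T n)`_k, (T n)`_k.+1[%classic :> set R.
    by rewrite -itv_bndbnd_setU // bnd_simp // ltW.
  have mU : measurable_fun `[0, (T n)`_k.+1[%classic f.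
    by rewrite U; apply/measurable_funU.
  split => //; rewrite U integral_setU //=.
  - by rewrite If Ig big_nat_recr.
  - by apply/measurable_EFinP; rewrite -U.
  - apply/disj_setPS => t /= []; rewrite !in_itv /= => /andP[_ h] /andP[h' _].
    by move: (lt_le_trans h h'); rewrite ltxx.
have [mf If] := H _ (leqnn _).
rewrite (partition_last T_dyadic) in mf If.
rewrite -integral_itv_bndo_bndc; last exact/measurable_EFinP.
by have := congr1 fine If; apply.
Qed.

Lemma sum_cell n (c : nat -> R) k t : (k < 2 ^ n)%N -> cell T n k t ->
  \sum_(0 <= j < 2 ^ n) c j * \1_(`[(T n)`_j, (T n)`_j.+1[%classic) t = c k.
Proof.
move=> kn tk; rewrite big_mkord (bigD1 (Ordinal kn)) //= big1 => [|j jk].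
  by rewrite addr0 indicE mem_set ?mulr1 //= in_itv.
rewrite indicE memNset ?mulr0 //= in_itv /= => jt.
by move/eqP: jk; apply; apply/val_inj/(cell_inj T_dyadic _ _ jt tk).
Qed.

(** The parity of j tells whether the cell is the left or the right half of its
    parent, hence the sign. *)
Lemma V_cell n j t : (j < 2 ^ n.+1)%N -> cell T n.+1 j t ->
  V_ T n t = (-1) ^+ j / gap T n.+1 j.
Proof.
move=> jn tj; rewrite -(sum_cell (fun j => (-1) ^+ j / gap T n.+1 j) jn tj).
rewrite expnS sum_pairs; apply: eq_bigr => k _.
rewrite exprD expr1 exprM sqrrN expr1n expr1n !mul1r /gap.
by rewrite addn1 addn2 !mulN1r mulNr.
Qed.

Lemma vartheta_cell theta n k t : (k < 2 ^ n)%N -> cell T n k t ->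
  vartheta_ T theta n t = theta n k.
Proof. exact: sum_cell. Qed.

Lemma step_V n : step n.+1 (V_ T n).
Proof.
move=> k t kn tk; rewrite (V_cell kn tk) (V_cell kn) //.
exact: cell_left.
Qed.

Lemma step_vartheta theta n : step n (vartheta_ T theta n).
Proof.
move=> k t kn tk; rewrite (vartheta_cell _ kn tk) (vartheta_cell _ kn) //.
exact: cell_left.
Qed.

End StepFunctions.

(** * Power inequalities *)

Section Powers.
Variable R : realType.
Implicit Types (a b p : R).

Lemma powR_le a b p : 0 <= p -> 0 <= a -> a <= b -> a `^ p <= b `^ p.
Proof.
by move=> p0 a0 ab; apply: ge0_ler_powR => //; rewrite nnegrE // (le_trans a0).
Qed.

(** Jensen's inequality for two points with weights that need not add up to 1. *)
Lemma powR_weighted_mean_le a b (v w : R) p : 1 <= p -> 0 <= a -> 0 <= b ->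
  0 < v -> 0 < w ->
  (v + w) * ((v * a + w * b) / (v + w)) `^ p <= v * a `^ p + w * b `^ p.
Proof.
move=> p1 a0 b0 v0 w0.
have vw : 0 < v + w by rewrite addr_gt0.
have t0 : 0 <= v / (v + w) by rewrite divr_ge0 // ltW.
have t1 : v / (v + w) <= 1 by rewrite ler_pdivrMr // mul1r lerDl ltW.
have := convex_powR p1 (Itv01 t0 t1) (x := a) (y := b).
rewrite !inE /= !in_itv /= !andbT => /(_ a0 b0).
have convE c d : conv (Itv01 t0 t1) (c : R^o) d = (v * c + w * d) / (v + w) :> R.
  by rewrite convRE /= /unstable.onem; field; rewrite gt_eqF.
rewrite [X in _ <= X]convE [X in X `^ _]convE.
move=> h; by rewrite mulrC -ler_pdivlMr.
Qed.

(** The constant is not optimal (convexity gives the exponent p - 1), but the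
    argument is immediate: each term is at most the p-th root of the sum on the
    right. *)
Lemma powR_sum_le (b : nat -> R) N p : 0 < p -> (forall i, 0 <= b i) ->
  (\sum_(0 <= i < N) b i) `^ p <= N%:R `^ p * \sum_(0 <= i < N) b i `^ p.
Proof.
move=> p0 b0; set S := \sum_(0 <= i < N) b i `^ p.
have S0 : 0 <= S by apply: sumr_ge0 => i _; exact: powR_ge0.
have -> : S = (S `^ p^-1) `^ p by rewrite -powRrM mulVf ?gt_eqF // powRr1.
rewrite -powRM //; last exact: powR_ge0.
apply: powR_le; [exact: ltW|exact: sumr_ge0|].
have -> : N%:R * S `^ p^-1 = \sum_(0 <= i < N) S `^ p^-1.
  by rewrite sumr_const_nat subn0 mulr_natl.
rewrite !big_nat; apply: ler_sum => i iN.
have -> : b i = (b i `^ p) `^ p^-1 by rewrite -powRrM mulfV ?gt_eqF // powRr1.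
apply: powR_le; [by rewrite invr_ge0 ltW|exact: powR_ge0|].
rewrite /S (bigD1_seq i) ?mem_index_iota ?iota_uniq //= lerDl.
by apply: sumr_ge0 => j _; exact: powR_ge0.
Qed.

Lemma powRD_le a b p : 0 <= p -> 0 <= a -> 0 <= b ->
  (a + b) `^ p <= 2 `^ p * (a `^ p + b `^ p).
Proof.
move=> p0 a0 b0; wlog ab : a b a0 b0 / a <= b => [hw|].
  case: (leP a b) => [|/ltW] h; first exact: hw.
  by rewrite addrC [X in _ * X]addrC; exact: hw.
apply: (@le_trans _ _ ((2 * b) `^ p)).
  by apply: powR_le => //; [rewrite addr_ge0|lra].
by rewrite powRM // ler_wpM2l ?powR_ge0 // lerDr powR_ge0.
Qed.

End Powers.

(** * The martingale of slopes *)

Section Slopes.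
Variables (R : realType) (T : nat -> seq R) (x : R -> R).
Hypothesis T_dyadic : dyadic_refinement T.

Local Notation theta := (faber_schauder T x).

Definition slope (n k : nat) : R := (x (T n)`_k.+1 - x (T n)`_k) / gap T n k.

(** The martingale difference between the levels n and n + 1. *)
Definition increment (n : nat) (t : R) : R := V_ T n t * vartheta_ T theta n t.

(** The martingale of slopes of the interpolants of x; see [slope_process_cell]. *)
Definition slope_process (n : nat) (t : R) : R :=
  (x 1 - x 0) + \sum_(0 <= m < n) increment m t.

(** The expectation of the p-th power of the modulus of the martingale at time n;
    see [mean_slope_process]. *)
Definition slope_moment (p : R) (n : nat) : R :=
  \sum_(0 <= k < 2 ^ n) gap T n k * `|slope n k| `^ p.

Lemma gap_split n k : (k < 2 ^ n)%N ->
  gap T n k = gap T n.+1 (2 * k) + gap T n.+1 (2 * k).+1.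
Proof.
move=> kn; rewrite /gap -(partition_even T_dyadic (ltnW kn)).
rewrite -(partition_even T_dyadic kn) mulnS !addSn add0n; ring.
Qed.

Lemma slope_split n k : (k < 2 ^ n)%N ->
  slope n k = (gap T n.+1 (2 * k) * slope n.+1 (2 * k) +
               gap T n.+1 (2 * k).+1 * slope n.+1 (2 * k).+1) / gap T n k.
Proof.
move=> kn; have n2 : (2 ^ n.+1 = 2 * 2 ^ n)%N by rewrite expnS.
rewrite /slope; congr (_ / _).
rewrite !(mulrC (gap _ _ _)) !divfK ?gt_eqF ?gap_gt0 //; try lia.
rewrite -(partition_even T_dyadic (ltnW kn)) -(partition_even T_dyadic kn).
rewrite mulnS !addSn add0n; ring.
Qed.

(** Multiplied by V_n, the Faber-Schauder coefficient of a cell is the correction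
    that turns the slope on this cell into the slopes on its two halves. *)
Lemma slope_process_cell n k t : (k < 2 ^ n)%N -> cell T n k t ->
  slope_process n t = slope n k.
Proof.
elim: n k => [|n IH] k kn tk.
  have -> : k = 0%N by case: k kn {tk}.
  rewrite /slope_process big_geq // addr0 /slope /gap.
  have := partition_last T_dyadic 0; rewrite expn0 => ->.
  by rewrite (partition_first T_dyadic) subr0 divr1.
have e := odd_double_half k; have n2 : (2 ^ n.+1 = 2 * 2 ^ n)%N by rewrite expnS.
have kn' : (k./2 < 2 ^ n)%N by lia.
rewrite /slope_process big_nat_recr //= addrA.
have tk' := cell_half T_dyadic kn tk.
rewrite -/(slope_process n t) (IH _ kn' tk') /increment.
rewrite (V_cell T_dyadic kn tk) (vartheta_cell T_dyadic _ kn' tk').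
move: (k./2) kn' e {tk' tk} => j jn e.
rewrite slope_split // /faber_schauder.
have g1 : 0 < gap T n.+1 (2 * j) by apply: gap_gt0 => //; lia.
have g2 : 0 < gap T n.+1 (2 * j).+1 by apply: gap_gt0 => //; lia.
have G := gap_split jn.
rewrite /slope G; move: g1 g2; rewrite -e -mul2n /gap addn1 addn2.
case: (odd k) => /=; rewrite ?add1n ?add0n -signr_odd /= ?oddM /=;
  rewrite ?expr0 ?expr1;
  move: (T n.+1)`_(2 * j) (T n.+1)`_(2 * j).+1 (T n.+1)`_(2 * j).+2 => a b c ab bc;
  field; rewrite ?andbT; repeat (apply/andP; split); rewrite gt_eqF //; lra.
Qed.

Lemma step_increment n : step T n.+1 (increment n).
Proof.
move=> k t kn tk; rewrite /increment (step_V T_dyadic kn tk); congr (_ * _).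
exact: (step_le T_dyadic (leqnSn n) (@step_vartheta _ _ T_dyadic theta n) kn tk).
Qed.

Lemma step_slope_process m n : (m <= n)%N -> step T n (slope_process m).
Proof.
move=> mn; apply: (step_le T_dyadic mn) => k t kn tk.
by rewrite !(@slope_process_cell _ k) ?cell_left.
Qed.

Lemma square_fun_increment n t :
  square_fun T theta n t = \sum_(0 <= m < n) increment m t ^+ 2.
Proof. by apply: eq_bigr => m _; rewrite exprMn. Qed.

Lemma square_fun_ge0 n t : 0 <= square_fun T theta n t.
Proof. by rewrite square_fun_increment; apply: sumr_ge0 => m _; exact: sqr_ge0. Qed.

Lemma step_square_fun n : step T n (square_fun T theta n).
Proof.
move=> k t kn tk; rewrite !square_fun_increment !big_nat; apply: eq_bigr => m mn.
by rewrite (step_le T_dyadic _ (@step_increment m) kn tk) //; case/andP: mn.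
Qed.

Lemma mean_slope_process p m n : (m <= n)%N ->
  mean T n (fun t => `|slope_process m t| `^ p) = slope_moment p m.
Proof.
move=> mn; have s k : (m <= k)%N -> step T k (fun t => `|slope_process m t| `^ p).
  by move=> mk j t jk tj; rewrite (step_slope_process mk jk tj).
rewrite -(expect_step T_dyadic (s _ mn)) (expect_step T_dyadic (s _ (leqnn m))).
rewrite /mean /slope_moment !big_nat; apply: eq_bigr => k km.
by rewrite (@slope_process_cell _ k) // cell_left.
Qed.

(** The slope on a cell is the mean of the slopes on its halves, weighted by their
    lengths, so that Jensen's inequality applies cell by cell: this is the
    submartingale property of the powers of a martingale. *)
Lemma slope_moment_le p m n : 1 <= p -> (m <= n)%N ->
  slope_moment p m <= slope_moment p n.
Proof.
move=> p1; elim: n => [|n IH]; first by rewrite leqn0 => /eqP ->.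
rewrite leq_eqVlt => /predU1P[->//|/IH/le_trans]; apply.
have n2 : (2 ^ n.+1 = 2 * 2 ^ n)%N by rewrite expnS.
rewrite /slope_moment expnS sum_pairs !big_nat; apply: ler_sum => k kn.
rewrite addn1 slope_split // gap_split //.
have g1 : 0 < gap T n.+1 (2 * k) by apply: gap_gt0 => //; lia.
have g2 : 0 < gap T n.+1 (2 * k).+1 by apply: gap_gt0 => //; lia.
move: g1 g2; set v := gap _ _ _; set w := gap _ _ _ => v0 w0.
apply: le_trans (powR_weighted_mean_le p1 (normr_ge0 _) (normr_ge0 _) v0 w0).
have vw : 0 <= v + w by rewrite addr_ge0 // ltW.
apply: (ler_wpM2l vw); apply: powR_le; [lra|exact: normr_ge0|].
rewrite normrM normfV (ger0_norm vw) ler_wpM2r ?invr_ge0 //.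
by apply: le_trans (ler_normD _ _) _; rewrite !normrM (gtr0_norm v0) (gtr0_norm w0).
Qed.

Lemma slope_moment0 p : slope_moment p 0 = `|x 1 - x 0| `^ p.
Proof.
rewrite /slope_moment expn0 big_nat1 /slope /gap.
have := partition_last T_dyadic 0; rewrite expn0 => ->.
by rewrite (partition_first T_dyadic) subr0 divr1 mul1r.
Qed.

Lemma slope_moment_ge0 p n : 0 <= slope_moment p n.
Proof.
rewrite /slope_moment big_nat; apply: sumr_ge0 => k kn.
by rewrite mulr_ge0 ?powR_ge0 // ltW // gap_gt0.
Qed.

(** A pointwise substitute for one half of the Burkholder inequality, at the
    price of the factor n: each increment is bounded by the root of the square
    function. *)
Lemma norm_slope_process_le n t :
  `|slope_process n t| <= `|x 1 - x 0| + n%:R * Num.sqrt (square_fun T theta n t).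
Proof.
apply: le_trans (ler_normD _ _) _; rewrite lerD2l.
apply: le_trans (ler_norm_sum _ _ _) _.
have -> : n%:R * Num.sqrt (square_fun T theta n t) =
    \sum_(0 <= i < n) Num.sqrt (square_fun T theta n t).
  by rewrite sumr_const_nat subn0 mulr_natl.
rewrite !big_nat; apply: ler_sum => m mn.
rewrite -sqrtr_sqr ler_wsqrtr // square_fun_increment.
rewrite (bigD1_seq m) ?mem_index_iota ?iota_uniq //= lerDl.
by apply: sumr_ge0 => j _; exact: sqr_ge0.
Qed.

(** A pointwise substitute for the other half: the Euclidean norm of the increments
    is at most their sum, and each increment is a difference of two values of
    the martingale. *)
Lemma sqrt_square_fun_le n t :
  Num.sqrt (square_fun T theta n t) <=
    2 * \sum_(0 <= m < n.+1) `|slope_process m t|.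
Proof.
apply: (@le_trans _ _ (\sum_(0 <= m < n) `|increment m t|)).
  rewrite square_fun_increment; elim: n => [|n IH].
    by rewrite !big_geq // sqrtr0.
  rewrite !big_nat_recr //=.
  have S0 : 0 <= \sum_(0 <= m < n) increment m t ^+ 2.
    by apply: sumr_ge0 => m _; exact: sqr_ge0.
  apply: le_trans (_ : Num.sqrt (\sum_(0 <= m < n) increment m t ^+ 2) +
    `|increment n t| <= _); last by rewrite lerD2r.
  rewrite -(ger0_norm (addr_ge0 (sqrtr_ge0 _) (normr_ge0 _))) -sqrtr_sqr.
  rewrite ler_wsqrtr // sqrrD sqr_sqrtr // real_normK ?num_real //.
  by rewrite addrAC lerDl mulrn_wge0 // mulr_ge0 ?sqrtr_ge0.
apply: (@le_trans _ _ (\sum_(0 <= m < n)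
    (`|slope_process m.+1 t| + `|slope_process m t|))).
  rewrite !big_nat; apply: ler_sum => m _.
  have -> : increment m t = slope_process m.+1 t - slope_process m t.
    by rewrite /slope_process big_nat_recr //=; ring.
  exact: ler_normB.
rewrite big_split /= mulr2n mulrDl !mul1r; apply: lerD.
  by rewrite [leRHS]big_nat_recl // lerDr.
by rewrite [leRHS]big_nat_recr //= lerDl.
Qed.

Definition square_moment (p : R) (n : nat) : R :=
  expect (fun t => square_fun T theta n t `^ (p / 2)).

Lemma square_momentE p n : square_moment p n =
  mean T n (fun t => Num.sqrt (square_fun T theta n t) `^ p).
Proof.
have e : (fun t => square_fun T theta n t `^ (p / 2)) =
    (fun t => Num.sqrt (square_fun T theta n t) `^ p).
  apply/funext => t; rewrite -powR12_sqrt ?square_fun_ge0 // -powRrM.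
  by rewrite mulrC.
rewrite /square_moment e; apply: expect_step => // k t kn tk.
by rewrite (step_square_fun kn tk).
Qed.

Lemma slope_moment_le_square p n : 1 <= p ->
  slope_moment p n <=
    2 `^ p * (`|x 1 - x 0| `^ p + n%:R `^ p * square_moment p n).
Proof.
move=> p1; have p0 : 0 <= p by lra.
rewrite -(mean_slope_process p (leqnn n)) square_momentE.
rewrite -[X in _ * (X + _)](mean_cst T_dyadic n) -!meanZ -meanD -meanZ.
apply: mean_le => // t.
rewrite -powRM ?sqrtr_ge0 //.
have s0 : 0 <= n%:R * Num.sqrt (square_fun T theta n t) by rewrite mulr_ge0 ?sqrtr_ge0.
apply: le_trans (powRD_le p0 (normr_ge0 _) s0).
by apply: powR_le => //; exact: norm_slope_process_le.
Qed.

Lemma square_moment_le_slope p n : 1 <= p ->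
  square_moment p n <= 2 `^ p * (n.+1%:R `^ p * (n.+1%:R * slope_moment p n)).
Proof.
move=> p1; have p0 : 0 < p by lra.
apply: (@le_trans _ _ (2 `^ p * (n.+1%:R `^ p *
    \sum_(0 <= m < n.+1) slope_moment p m))).
  rewrite square_momentE.
  have -> : \sum_(0 <= m < n.+1) slope_moment p m =
      mean T n (fun t => \sum_(0 <= m < n.+1) `|slope_process m t| `^ p).
    rewrite mean_sum !big_nat; apply: eq_bigr => m /andP[_ mn].
    by rewrite mean_slope_process.
  rewrite -!meanZ; apply: mean_le => // t.
  apply: le_trans (_ : (2 * \sum_(0 <= m < n.+1) `|slope_process m t|) `^ p <= _).
    by apply: powR_le; [exact: ltW|exact: sqrtr_ge0|exact: sqrt_square_fun_le].
  rewrite powRM //; last exact: sumr_ge0.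
  by rewrite ler_wpM2l ?powR_ge0 //; exact: powR_sum_le.
rewrite !ler_wpM2l ?powR_ge0 //.
have -> : n.+1%:R * slope_moment p n = \sum_(0 <= m < n.+1) slope_moment p n.
  by rewrite sumr_const_nat subn0 mulr_natl.
rewrite !big_nat; apply: ler_sum => m /andP[_ mn]; exact: slope_moment_le.
Qed.

(** On the j-th cell of level m + 1 the square of the m-th increment is
    theta^2 / gap^2; integrating over the cell leaves one factor 1 / gap. *)
Lemma expect_square_fun n : expect (square_fun T theta n) =
  \sum_(0 <= m < n) \sum_(0 <= k < 2 ^ m) theta m k ^+ 2 *
    ((gap T m.+1 (2 * k))^-1 + (gap T m.+1 (2 * k).+1)^-1).
Proof.
rewrite (expect_step T_dyadic (@step_square_fun n)).
have -> : square_fun T theta n = fun t => \sum_(0 <= m < n) increment m t ^+ 2.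
  by apply/funext => t; exact: square_fun_increment.
rewrite mean_sum !big_nat; apply: eq_bigr => m /andP[_ mn].
have s k : (m < k)%N -> step T k (fun t => increment m t ^+ 2).
  move=> mk j t jk tj.
  by rewrite (step_le T_dyadic mk (@step_increment m) jk tj).
rewrite -(expect_step T_dyadic (s _ mn)) (expect_step T_dyadic (s _ (ltnSn m))).
rewrite /mean expnS sum_pairs !big_nat; apply: eq_bigr => k /andP[_ km].
have m2 : (2 ^ m.+1 = 2 * 2 ^ m)%N by rewrite expnS.
have cellE j : (j < 2 ^ m.+1)%N -> j./2 = k ->
    gap T m.+1 j * increment m (T m.+1)`_j ^+ 2 = theta m k ^+ 2 * (gap T m.+1 j)^-1.
  move=> jm jk; have jj := cell_left T_dyadic jm.
  have jk' := cell_half T_dyadic jm jj; rewrite jk in jk'.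
  rewrite /increment (V_cell T_dyadic jm jj) (vartheta_cell T_dyadic _ km jk').
  rewrite !exprMn sqrr_sign mul1r; field.
  by rewrite gt_eqF // gap_gt0.
rewrite addn1 !cellE ?mulrDr //; lia.
Qed.

End Slopes.

(** * Well-balanced partitions *)

Section FiniteBounds.
Variable R : realType.

Lemma finite_upper_bound (f : nat -> R) N :
  exists C, forall k, (k < N)%N -> f k <= C.
Proof.
elim: N => [|N [C CP]]; first by exists 0.
exists (Num.max C (f N)) => k; rewrite ltnS leq_eqVlt le_max => /predU1P[->|/CP->//].
by rewrite lexx orbT.
Qed.

Lemma finite_positive_lower_bound (f : nat -> R) N :
  (forall k, (k < N)%N -> 0 < f k) ->
  exists2 c, 0 < c & forall k, (k < N)%N -> c <= f k.
Proof.
elim: N => [|N IH] f0; first by exists 1.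
have [k kN|c c0 cP] := IH; first by apply: f0; apply: ltnW.
exists (Num.min c (f N)); first by rewrite lt_min c0 f0.
move=> k; rewrite ltnS leq_eqVlt ge_min => /predU1P[->|/cP->//].
by rewrite lexx orbT.
Qed.

End FiniteBounds.

Section WellBalanced.
Variables (R : realType) (T : nat -> seq R).
Hypothesis T_dyadic : dyadic_refinement T.

Lemma gapsP n r : gaps (T n) r <-> exists2 k, (k < 2 ^ n)%N & gap T n k = r.
Proof.
split=> [[k /=]|[k kn <-]].
  rewrite size_partition // ltnS => kn <-; exists k => //.
  by rewrite gtr0_norm // gap_gt0.
exists k; first by rewrite /= size_partition.
by rewrite -/(gap T n k) gtr0_norm // gap_gt0.
Qed.

Lemma gap_le_mesh n k : (k < 2 ^ n)%N -> gap T n k <= mesh (T n).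
Proof.
move=> kn; apply: ub_le_sup; last by apply/gapsP; exists k.
have [C CP] := finite_upper_bound (gap T n) (2 ^ n).
by exists C => r /gapsP[j jn <-]; exact: CP.
Qed.

Lemma min_gap_le_gap n k : (k < 2 ^ n)%N -> min_gap (T n) <= gap T n k.
Proof.
move=> kn; apply: ge_inf; last by apply/gapsP; exists k.
by exists 0 => r /gapsP[j jn <-]; rewrite ltW // gap_gt0.
Qed.

Lemma min_gap_gt0 n : 0 < min_gap (T n).
Proof.
have [c c0 cP] := finite_positive_lower_bound (@gap_gt0 _ _ T_dyadic n).
apply: lt_le_trans c0 _; apply: lb_le_inf.
  by exists (gap T n 0); apply/gapsP; exists 0%N => //; rewrite expn_gt0.
by move=> r /gapsP[j jn <-]; exact: cP.
Qed.

Lemma sum_gap_level n : \sum_(0 <= k < 2 ^ n) gap T n k = 1.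
Proof. by rewrite sum_gap // partition_last. Qed.

Lemma mesh_ge n : 2 ^- n <= mesh (T n).
Proof.
rewrite -div1r ler_pdivrMr ?exprn_gt0 // -[leLHS](sum_gap_level n) -natrX mulr_natr.
have -> : mesh (T n) *+ 2 ^ n = \sum_(0 <= k < 2 ^ n) mesh (T n).
  by rewrite sumr_const_nat subn0.
by rewrite !big_nat; apply: ler_sum => k kn; exact: gap_le_mesh.
Qed.

Lemma min_gap_le n : min_gap (T n) <= 2 ^- n.
Proof.
rewrite -div1r ler_pdivlMr ?exprn_gt0 // -[leRHS](sum_gap_level n) -natrX mulr_natr.
have -> : min_gap (T n) *+ 2 ^ n = \sum_(0 <= k < 2 ^ n) min_gap (T n).
  by rewrite sumr_const_nat subn0.
by rewrite !big_nat; apply: ler_sum => k kn; exact: min_gap_le_gap.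
Qed.

(** The gaps of level n add up to 1, so that the mesh and the minimal gap lie on
    either side of 2^-n; a bound on their ratio makes all gaps comparable to
    2^-n. *)
Lemma well_balanced_gap : well_balanced T ->
  exists kappa : nat -> R,
    [/\ forall m n, (m <= n)%N -> kappa m <= kappa n,
        subexponential kappa, forall n, 1 <= kappa n &
        forall n k, (k < 2 ^ n)%N ->
          (kappa n)^-1 * 2 ^- n <= gap T n k /\ gap T n k <= kappa n * 2 ^- n].
Proof.
move=> [kappa [km ks kP]]; exists kappa.
have ratio n : mesh (T n) / min_gap (T n) <= kappa n.
  apply: le_trans (kP n); apply: ub_le_sup; last by exists n => /=.
  have [C CP] := finite_upper_bound (fun k => mesh (T k) / min_gap (T k)) n.+1.
  by exists C => r [k /= kn <-]; exact: CP.
have meshk n : mesh (T n) <= kappa n * min_gap (T n).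
  by rewrite -ler_pdivrMr ?min_gap_gt0.
have k1 n : 1 <= kappa n.
  apply: le_trans (ratio n); rewrite ler_pdivlMr ?min_gap_gt0 // mul1r.
  by apply: (@le_trans _ _ (gap T n 0)); [apply: min_gap_le_gap|apply: gap_le_mesh];
    rewrite expn_gt0.
split=> // n k kn; have k0 : 0 < kappa n by apply: lt_le_trans (k1 n).
split.
  apply: le_trans (min_gap_le_gap kn).
  rewrite mulrC ler_pdivrMr // mulrC.
  exact: le_trans (mesh_ge n) (meshk n).
apply: le_trans (gap_le_mesh kn) _; apply: le_trans (meshk n) _.
by rewrite ler_wpM2l ?min_gap_le // ltW.
Qed.

End WellBalanced.

(** * Subexponential sequences *)

Section Subexponential.
Variable R : realType.
Implicit Types u v : nat -> R.

Lemma subexponentialM u v : (forall n, (0 < n)%N -> 0 < u n) ->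
  (forall n, (0 < n)%N -> 0 < v n) -> subexponential u -> subexponential v ->
  subexponential (fun n => u n * v n).
Proof.
move=> u0 v0 us vs; rewrite /subexponential -[0]addr0.
apply: cvg_trans (cvgD us vs); apply: near_eq_cvg.
near=> n; have n0 : (0 < n)%N by near: n; exact: nbhs_infty_gt.
by rewrite /= lnM ?posrE ?u0 ?v0 // mulrDr.
Unshelve. all: by end_near. Qed.

Lemma subexponential_powR u p : subexponential u ->
  subexponential (fun n => u n `^ p).
Proof.
move=> us; rewrite /subexponential -(mulr0 p).
apply: cvg_trans (cvgM (cvg_cst p) us); apply: near_eq_cvg; near=> n.
by rewrite /= ln_powR mulrCA.
Unshelve. all: by end_near. Qed.

Lemma cvg_inv_nat : (n%:R^-1 : R) @[n --> \oo] --> (0 : R).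
Proof.
apply/cvgrPdist_lt => e e0; near=> n.
have h : e^-1 < n%:R by near: n; exact: nbhs_infty_gtr.
have n0 : 0 < n%:R :> R by apply: lt_trans h; rewrite invr_gt0.
by rewrite sub0r normrN gtr0_norm ?invr_gt0 // -(invrK e) ltf_pV2 ?posrE // invr_gt0.
Unshelve. all: by end_near. Qed.

Lemma cvg_inv_nat_mul (c : R) : n%:R^-1 * c @[n --> \oo] --> (0 : R).
Proof. by rewrite -(mul0r c); exact: cvgM cvg_inv_nat (cvg_cst _). Qed.

Lemma subexponential_cst (c : R) : subexponential (fun=> c).
Proof. exact: cvg_inv_nat_mul. Qed.

(** It follows from ln y < y for y the square root of n + 1. *)
Lemma subexponential_succ : subexponential (fun n => n.+1%:R : R).
Proof.
apply/cvgrPdist_lt => e e0; near=> n.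
have n0 : (0 < n)%N by near: n; exact: nbhs_infty_gt.
have h : (4 / e) ^+ 2 < n%:R by near: n; exact: nbhs_infty_gtr.
have nr : 0 < n%:R :> R by rewrite ltr0n.
have l0 : 0 <= ln (n.+1%:R : R) by rewrite ln_ge0 // ler1n.
rewrite sub0r normrN ger0_norm; last by rewrite mulr_ge0 // invr_ge0 ltW.
set q := Num.sqrt (n%:R : R).
have q0 : 0 < q by rewrite sqrtr_gt0.
have qq : q ^+ 2 = n%:R by rewrite sqr_sqrtr // ltW.
have hq : 4 / e < q.
  by rewrite -ltr_sqr ?nnegrE ?qq // ?divr_ge0 // ltW.
have l1 : ln (n.+1%:R : R) <= 4 * q.
  have s0 : 0 < Num.sqrt (n.+1%:R : R) by rewrite sqrtr_gt0 ltr0n.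
  have -> : n.+1%:R = Num.sqrt (n.+1%:R : R) ^+ 2 by rewrite sqr_sqrtr // ler0n.
  rewrite lnXn // [leLHS]mulr2n.
  have := ln_sublinear s0.
  have : Num.sqrt (n.+1%:R : R) <= 2 * q.
    rewrite -ler_sqr ?nnegrE ?sqrtr_ge0 //; last by rewrite mulr_ge0 // ltW.
    rewrite sqr_sqrtr ?ler0n // exprMn qq -natr1.
    have : (1 : R) <= n%:R by rewrite ler1n.
    lra.
  lra.
rewrite mulrC ltr_pdivrMr // -qq expr2 mulrA.
apply: le_lt_trans l1 _; rewrite ltr_pM2r //.
by rewrite mulrC -ltr_pdivrMr.
Unshelve. all: by end_near. Qed.

End Subexponential.

(** * Comparison of p-variation and weighted coefficients *)

Section Comparison.
Variables (R : realType) (T : nat -> seq R) (x : R -> R).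
Hypothesis T_dyadic : dyadic_refinement T.

Local Notation theta := (faber_schauder T x).
Local Notation s := (s_ theta).

(** The size of the martingale of slopes: its initial value is needed besides s,
    which only sees the increments. *)
Definition amplitude (n : nat) : R := `|x 1 - x 0| + s n.

Lemma s_ge0 n : 0 <= s n. Proof. exact: sqrtr_ge0. Qed.

Lemma amplitude_ge0 n : 0 <= amplitude n.
Proof. by rewrite addr_ge0 ?s_ge0. Qed.

Lemma sqr_s n : s n ^+ 2 =
  \sum_(0 <= m < n) \sum_(0 <= k < 2 ^ m) 2 ^+ m * theta m k ^+ 2.
Proof.
rewrite sqr_sqrtr //; apply: sumr_ge0 => m _; apply: sumr_ge0 => k _.
by rewrite mulr_ge0 ?sqr_ge0 ?exprn_ge0.
Qed.

Lemma s_le m n : (m <= n)%N -> s m <= s n.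
Proof.
move=> mn; rewrite /s_; apply: ler_wsqrtr.
rewrite [leRHS](big_cat_nat (leq0n m) mn) //= lerDl; apply: sumr_ge0 => k _.
by apply: sumr_ge0 => j _; rewrite mulr_ge0 ?sqr_ge0 ?exprn_ge0.
Qed.

Section Balance.
Variable kappa : nat -> R.
Hypotheses (kappa_le : forall m n, (m <= n)%N -> kappa m <= kappa n)
  (kappa_ge1 : forall n, 1 <= kappa n)
  (kappa_gap : forall n k, (k < 2 ^ n)%N ->
    (kappa n)^-1 * 2 ^- n <= gap T n k /\ gap T n k <= kappa n * 2 ^- n).

Let kappa_gt0 n : 0 < kappa n.
Proof. exact: lt_le_trans (kappa_ge1 n). Qed.

(** Bounds at all levels m <= n are stated with the single constant kappa n. *)
Lemma gap_inv_bounds m n k : (m <= n)%N -> (k < 2 ^ m)%N ->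
  (gap T m k)^-1 <= kappa n * 2 ^+ m /\ 2 ^+ m <= kappa n * (gap T m k)^-1.
Proof.
move=> mn km; have [h1 h2] := kappa_gap km; have g0 := gap_gt0 T_dyadic km.
have w0 : (0 : R) < 2 ^+ m by rewrite exprn_gt0.
split.
  apply: (@le_trans _ _ (kappa m * 2 ^+ m)); last by rewrite ler_pM2r // kappa_le.
  rewrite -[leRHS]invrK lef_pV2 ?posrE ?invr_gt0 ?mulr_gt0 //.
  by rewrite invfM.
apply: (@le_trans _ _ (kappa m / gap T m k)).
  by rewrite ler_pdivlMr // mulrC -ler_pdivlMr.
by rewrite ler_pM2r ?invr_gt0 // kappa_le.
Qed.

Lemma expect_square_fun_bounds n :
  expect (square_fun T theta n) <= 4 * kappa n * s n ^+ 2 /\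
  s n ^+ 2 <= kappa n * expect (square_fun T theta n).
Proof.
rewrite (expect_square_fun _ T_dyadic) sqr_s !mulr_sumr.
have b m k : (m < n)%N -> (k < 2 ^ m)%N ->
    (gap T m.+1 (2 * k))^-1 + (gap T m.+1 (2 * k).+1)^-1 <= 4 * kappa n * 2 ^+ m /\
    2 ^+ m <= kappa n * ((gap T m.+1 (2 * k))^-1 + (gap T m.+1 (2 * k).+1)^-1).
  move=> mn km; have m2 : (2 ^ m.+1 = 2 * 2 ^ m)%N by rewrite expnS.
  have [|a1 a2] := @gap_inv_bounds m.+1 n (2 * k) mn; first by lia.
  have [|b1 b2] := @gap_inv_bounds m.+1 n (2 * k).+1 mn; first by lia.
  have w0 : (0 : R) < 2 ^+ m by rewrite exprn_gt0.
  rewrite exprS in a1 a2 b1 b2; rewrite mulrDr; split; lra.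
split; rewrite !big_nat; apply: ler_sum => m /andP[_ mn];
  rewrite !mulr_sumr !big_nat; apply: ler_sum => k /andP[_ km];
  have [h1 h2] := b _ _ mn km.
  by rewrite [leRHS]mulrA [leLHS]mulrC; apply: ler_wpM2r; rewrite ?sqr_ge0.
by rewrite [leRHS]mulrCA [leLHS]mulrC; apply: ler_wpM2l; rewrite ?sqr_ge0.
Qed.

(** An increment of x over a gap contributes |slope|^p * gap^p to the p-variation
    and |slope|^p * gap to the moment; the quotient gap^(p - 1) is 2^(-n(p - 1))
    up to a power of kappa. *)
Lemma p_variation_slope_moment p n : 1 <= p ->
  p_variation T x p n <= kappa n `^ (p - 1) * (2 ^- n) `^ (p - 1) * slope_moment T x p n /\
  (2 ^- n) `^ (p - 1) * slope_moment T x p n <= kappa n `^ (p - 1) * p_variation T x p n.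
Proof.
move=> p1; have p0 : 0 < p by lra.
have w0 : (0 : R) <= 2 ^- n by rewrite invr_ge0 exprn_ge0.
have pm1 : 0 <= p - 1 by lra.
have k0 := kappa_gt0 n.
have e k : (k < 2 ^ n)%N -> `|x (T n)`_k.+1 - x (T n)`_k| `^ p =
    gap T n k `^ (p - 1) * (gap T n k * `|slope T x n k| `^ p).
  move=> kn; have g0 := gap_gt0 T_dyadic kn.
  rewrite mulrA [_ * gap _ _ _]mulrC mulr_powRB1 ?(ltW g0) // -powRM ?(ltW g0) //.
  by rewrite /slope normrM normfV (gtr0_norm g0) mulrCA mulfV ?mulr1 // gt_eqF.
rewrite -powRM ?(ltW k0) // /p_variation /slope_moment !mulr_sumr !big_nat.
split; apply: ler_sum => k /andP[_ kn]; have [h1 h2] := kappa_gap kn;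
  have g0 := gap_gt0 T_dyadic kn;
  have S0 : 0 <= gap T n k * `|slope T x n k| `^ p
    by rewrite mulr_ge0 ?powR_ge0 // ltW.
- by rewrite (e _ kn) ler_wpM2r // powR_le // ltW.
- rewrite (e _ kn) [leRHS]mulrA ler_wpM2r // -powRM ?(ltW k0) ?(ltW g0) // powR_le //.
  by rewrite -ler_pdivrMl.
Qed.

End Balance.
End Comparison.

Section Growth.
Variables (R : realType) (T : nat -> seq R) (x : R -> R).
Hypotheses (T_dyadic : dyadic_refinement T) (T_balanced : well_balanced T)
  (x_jensen : reverse_jensen T (faber_schauder T x)).

Local Notation theta := (faber_schauder T x).
Local Notation s := (s_ theta).
Local Notation A := (amplitude T x).

Lemma powR_sqr_half (a p : R) : 0 <= a -> (a ^+ 2) `^ (p / 2) = a `^ p.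
Proof.
move=> a0; rewrite -powR_mulrn // -powRrM; congr (_ `^ _).
by rewrite mulrC divfK.
Qed.

Lemma powR_ge1 (a p : R) : 0 <= p -> 1 <= a -> 1 <= a `^ p.
Proof. by move=> p0 a1; have := powR_le p0 ler01 a1; rewrite powR1. Qed.

(** All comparisons are collected here. In K, the factor D accounts for the
    passage from the moment of slopes to the amplitude in both directions, and
    the remaining power of kappa for the passage from p-variation to slopes. *)
Lemma p_variation_amplitude p : 1 <= p ->
  exists K : nat -> R,
    [/\ forall n, (0 < n)%N -> 0 < K n, subexponential K &
      forall n, (0 < n)%N ->
        p_variation T x p n <= K n * ((2 ^- n) `^ (p - 1) * A n `^ p) /\
        (2 ^- n) `^ (p - 1) * A n `^ p <= K n * p_variation T x p n].
Proof.
move=> p1; have p0 : 0 <= p by lra.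
have [kappa [kappa_le kappa_sub kappa_ge1 kappa_gap]] :=
  well_balanced_gap T_dyadic T_balanced.
have [rho [rho_ge1 _ rho_sub rho_jensen]] := x_jensen p1.
have kappa_gt0 n : 0 < kappa n by apply: lt_le_trans (kappa_ge1 n).
have rho_gt0 n : (0 < n)%N -> 0 < rho n by move=> /rho_ge1; apply: lt_le_trans.
have N0 n : 0 < n.+1%:R :> R by rewrite ltr0n.
pose t : R := 2 `^ p.
have t1 : 1 <= t by apply: powR_ge1 => //; lra.
have t0 : 0 < t by exact: lt_le_trans t1.
pose D n := t * (n.+1%:R `^ p * n.+1%:R * rho n * kappa n `^ (p / 2)).
have D0 n : (0 < n)%N -> 0 < D n.
  by move=> n0; rewrite !mulr_gt0 ?powR_gt0 ?rho_gt0 // /t powR_gt0.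
exists (fun n => kappa n `^ (p - 1) * (2 * t * D n)); split.
- move=> n n0; apply: mulr_gt0; first exact: powR_gt0.
  by apply: mulr_gt0 (D0 n n0); rewrite mulr_gt0.
- have P n : 0 < n.+1%:R `^ p :> R by rewrite powR_gt0.
  have Q n q : 0 < kappa n `^ q by rewrite powR_gt0.
  have S1 := @subexponential_succ R.
  apply: subexponentialM; [by []|by move=> n n0; apply: mulr_gt0 (D0 n n0); rewrite mulr_gt0| |].
    exact: subexponential_powR.
  apply: subexponentialM; [by move=> *; rewrite mulr_gt0|exact: D0| |].
    exact: subexponential_cst.
  apply: subexponentialM; [by []|by move=> n n0; rewrite !mulr_gt0 ?rho_gt0| |].
    exact: subexponential_cst.
  apply: subexponentialM; [by move=> n n0; rewrite !mulr_gt0 ?rho_gt0|by []| |];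
    last exact: subexponential_powR.
  apply: subexponentialM; [by move=> n n0; rewrite !mulr_gt0|exact: rho_gt0| |by []].
  apply: subexponentialM; [by []|by []| |exact: S1].
  exact: subexponential_powR.
move=> n n0.
have [E1 E2] := expect_square_fun_bounds x T_dyadic kappa_le kappa_ge1 kappa_gap n.
have [J1 J2] := rho_jensen n n0.
have [P1 P2] := p_variation_slope_moment x T_dyadic kappa_ge1 kappa_gap n p1.
have U := slope_moment_le_square x T_dyadic n p1.
have L := square_moment_le_slope x T_dyadic n p1.
have M0 : `|x 1 - x 0| `^ p <= slope_moment T x p n.
  by rewrite -(slope_moment0 x T_dyadic); exact: slope_moment_le.
have s0 := s_ge0 T x n; have A0 := amplitude_ge0 T x n.
have E0 : 0 <= expect (square_fun T theta n).
  rewrite -(pmulr_rge0 _ (kappa_gt0 n)); apply: le_trans E2; exact: sqr_ge0.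
have a0 := slope_moment_ge0 x T_dyadic p n.
rewrite /= -/(square_moment T x p n) in J1 J2.
set a := slope_moment T x p n in P1 P2 U L M0 a0 *.
set B := square_moment T x p n in U L J1 J2.
set Ex := expect _ in E1 E2 J1 J2 E0.
set Q := kappa n `^ (p / 2).
have Q1 : 1 <= Q by apply: powR_ge1 => //; lra.
have r1 := rho_ge1 n n0.
set P : R := n.+1%:R `^ p.
have N1 : 1 <= n.+1%:R :> R by rewrite ler1n.
have Pge1 : 1 <= P by apply: powR_ge1.
set N : R := n.+1%:R in N1.
have DE : D n = t * (P * N * rho n * Q) by [].
have D1 : 1 <= D n.
  by rewrite DE; do 4 (apply: mulr_ege1 => //).
have p20 : 0 <= p / 2 by lra.
have Ms : s n `^ p <= A n `^ p by apply: powR_le => //; rewrite lerDr.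
have MA : `|x 1 - x 0| `^ p <= A n `^ p by apply: powR_le => //; rewrite lerDl.
have EU : Ex `^ (p / 2) <= t * Q * A n `^ p.
  apply: (@le_trans _ _ ((4 * kappa n * s n ^+ 2) `^ (p / 2))); first exact: powR_le.
  have k0 := ltW (kappa_gt0 n).
  have -> : (4 : R) = 2 ^+ 2 by ring.
  rewrite powRM ?sqr_ge0 // ?mulr_ge0 ?sqr_ge0 // [(_ * kappa n) `^ _]powRM ?sqr_ge0 //.
  rewrite !powR_sqr_half // -/t -/Q ler_wpM2l // mulr_ge0; lra.
have sL : s n `^ p <= Q * Ex `^ (p / 2).
  rewrite -powR_sqr_half // /Q -powRM ?(ltW (kappa_gt0 n)) //.
  by apply: powR_le => //; exact: sqr_ge0.
have A0p : 0 <= A n `^ p by exact: powR_ge0.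
have aU : a <= 2 * t * D n * A n `^ p.
  apply: le_trans U _.
  have h : n%:R `^ p * B <= D n * A n `^ p.
    have -> : D n * A n `^ p = P * (N * (rho n * (t * Q * A n `^ p))).
      by rewrite DE; ring.
    have hB : B <= rho n * (t * Q * A n `^ p).
      by apply: le_trans J2 _; rewrite ler_wpM2l //; lra.
    have hB0 : 0 <= rho n * (t * Q * A n `^ p).
      by rewrite !mulr_ge0 //; lra.
    apply: ler_pM; [exact: powR_ge0| |by apply: powR_le => //; rewrite ler_nat|].
      by rewrite /B square_momentE //; apply: mean_ge0 => // r; exact: powR_ge0.
    by apply: le_trans hB _; rewrite ler_peMl.
  have h' : A n `^ p <= D n * A n `^ p by rewrite ler_peMl.
  have -> : 2 * t * D n * A n `^ p = t * (2 * (D n * A n `^ p)) by ring.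
  apply: (ler_wpM2l (ltW t0)); lra.
have aL : A n `^ p <= 2 * t * D n * a.
  apply: le_trans (powRD_le p0 (normr_ge0 _) s0) _; rewrite -/t.
  have h : s n `^ p <= D n * a.
    apply: le_trans sL _.
    have -> : D n * a = Q * (rho n * (t * (P * (N * a)))) by rewrite DE; ring.
    rewrite ler_wpM2l //; first by lra.
    rewrite -ler_pdivrMl ?rho_gt0 //.
    exact: le_trans J1 L.
  have h' : a <= D n * a by rewrite ler_peMl.
  have -> : 2 * t * D n * a = t * (2 * (D n * a)) by ring.
  apply: (ler_wpM2l (ltW t0)); lra.
have W0 : 0 <= (2 ^- n : R) `^ (p - 1) by exact: powR_ge0.
have K0 : 0 <= kappa n `^ (p - 1) by exact: powR_ge0.
split.
  apply: le_trans P1 _; rewrite -mulrA -[leRHS]mulrA; apply: (ler_wpM2l K0).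
  apply: le_trans (ler_wpM2l W0 aU) _.
  by rewrite [leLHS]mulrCA mulrA.
apply: le_trans (ler_wpM2l W0 aL) _.
have -> : (2 ^- n) `^ (p - 1) * (2 * t * D n * a) =
  (2 * t * D n) * ((2 ^- n) `^ (p - 1) * a) by ring.
rewrite [_ * (2 * t * D n)]mulrC -[leRHS]mulrA; apply: ler_wpM2l P2.
by apply/ltW/mulr_gt0; [rewrite mulr_gt0|exact: D0].
Qed.

(** If some s N is positive, s n stays above it and the initial slope is absorbed
    in a constant factor. Otherwise x is affine along the partitions, the
    amplitude is constant, and ln 0 = 0 makes the claim hold as well. *)
Lemma amplitude_ln_bound N0 : 0 < A N0 ->
  exists c N, forall n, (N <= n)%N -> 0 < A n /\ `|ln (A n) - ln (s n)| <= c.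
Proof.
move=> A0; have [s0|] := pselect (exists N, 0 < s N).
  have [N sN] := s0; have C1 : 1 <= 1 + `|x 1 - x 0| / s N.
    by rewrite lerDl divr_ge0 // ltW.
  exists (ln (1 + `|x 1 - x 0| / s N)), N => n Nn.
  have sn : 0 < s n by apply: lt_le_trans sN _; exact: s_le.
  have An : 0 < A n by rewrite ltr_wpDl.
  split=> //.
  have sA : s n <= A n by rewrite lerDr.
  have As : A n <= (1 + `|x 1 - x 0| / s N) * s n.
    rewrite [leRHS]mulrDl mul1r /amplitude addrC lerD2l mulrAC ler_pdivlMr //.
    by rewrite ler_wpM2l // s_le.
  have l1 : ln (s n) <= ln (A n) by rewrite ler_ln ?posrE.
  rewrite ger0_norm ?subr_ge0 // lerBlDr -lnM ?posrE //.
    by rewrite ler_ln ?posrE // mulr_gt0 // (lt_le_trans _ C1).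
  by rewrite (lt_le_trans _ C1).
move=> ns; have sz n : s n = 0.
  apply/eqP; rewrite eq_le s_ge0 andbT leNgt; apply/negP => h.
  by apply: ns; exists n.
exists `|ln (`|x 1 - x 0|)|, 0%N => n _; move: A0.
by rewrite /amplitude !sz !addr0 (ln0 (lexx 0)) subr0.
Qed.

(** The exponential growth rate of the p-variation is asymptotically an affine
    function of the estimator. *)
Lemma ln_p_variation_Rhat p N0 : 1 <= p -> 0 < A N0 ->
  n%:R^-1 * ln (p_variation T x p n) - (1 - p * Rhat T x n) * ln 2
    @[n --> \oo] --> (0 : R).
Proof.
move=> p1 A0; have [K [K0 Ksub KP]] := p_variation_amplitude p1.
have [c [N cP]] := amplitude_ln_bound A0.
apply/norm_cvg0P.
have H : n%:R^-1 * ln (K n) + n%:R^-1 * (p * c) @[n --> \oo] --> (0 : R).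
  by rewrite -[0]addr0; apply: cvgD => //; exact: cvg_inv_nat_mul.
apply: (@squeeze_cvgr _ _ _ _ (fun=> 0) _ _ _ _ (cvg_cst _) H).
near=> n; rewrite normr_ge0 /=.
have n0 : (0 < n)%N by near: n; exact: nbhs_infty_gt.
have Nn : (N <= n)%N by near: n; exact: nbhs_infty_ge.
have [An Ac] := cP n Nn; have [h1 h2] := KP n n0; have Kn := K0 n n0.
have nr : n%:R != 0 :> R by rewrite pnatr_eq0 -lt0n.
set W : R := (2 ^- n) `^ (p - 1) in h1 h2.
have W0 : 0 < W by rewrite powR_gt0 // invr_gt0 exprn_gt0.
have Ap : 0 < A n `^ p by rewrite powR_gt0.
have v0 : 0 < p_variation T x p n.
  by rewrite -(pmulr_rgt0 _ Kn); apply: lt_le_trans h2; rewrite mulr_gt0.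
have l1 : ln (p_variation T x p n) <= ln (K n) + (ln W + p * ln (A n)).
  rewrite -ln_powR -!lnM ?posrE ?mulr_gt0 //.
  by rewrite ler_ln ?posrE ?mulr_gt0.
have l2 : ln W + p * ln (A n) <= ln (K n) + ln (p_variation T x p n).
  rewrite -ln_powR -!lnM ?posrE ?mulr_gt0 //.
  by rewrite ler_ln ?posrE ?mulr_gt0.
have lW : ln W = (1 - p) * (n%:R * ln 2).
  rewrite /W ln_powR lnV ?posrE ?exprn_gt0 // lnXn // -mulr_natl; ring.
rewrite -mulrDr.
have -> : n%:R^-1 * ln (p_variation T x p n) - (1 - p * Rhat T x n) * ln 2 =
   n%:R^-1 * (ln (p_variation T x p n) - ln W - p * ln (s n)).
  rewrite lW /Rhat; field; rewrite nr /=.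
  by rewrite gt_eqF // ln_gt0 // ltr1n.
rewrite normrM gtr0_norm ?invr_gt0 ?ltr0n //.
rewrite ler_wpM2l ?invr_ge0 //.
have p0 : 0 <= p by lra.
have := ler_wpM2l p0 Ac; rewrite -[X in X * `|_|](ger0_norm p0) -normrM mulrBr.
rewrite ler_norml => /andP[k1 k2]; rewrite ler_norml; apply/andP; split; lra.
Unshelve. all: by end_near. Qed.

End Growth.

(** * Variation of a nonconstant continuous function *)

Section Variation.
Variables (R : realType) (T : nat -> seq R) (x : R -> R).
Hypotheses (T_dyadic : dyadic_refinement T)
  (x_cont : {within `[0, 1], continuous x}).

Lemma p_variation_ge0 p n : 0 <= p_variation T x p n.
Proof. by apply: sumr_ge0 => k _; exact: powR_ge0. Qed.

Lemma p_variation1 n : p_variation T x 1 n = slope_moment T x 1 n.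
Proof.
rewrite /p_variation /slope_moment !big_nat; apply: eq_bigr => k /andP[_ kn].
have g0 := gap_gt0 T_dyadic kn.
rewrite !powRr1 // /slope normrM normfV (gtr0_norm g0) mulrCA mulfV ?mulr1 //.
by rewrite gt_eqF.
Qed.

Lemma p_variation1_le m n : (m <= n)%N -> p_variation T x 1 m <= p_variation T x 1 n.
Proof. by move=> mn; rewrite !p_variation1; exact: slope_moment_le. Qed.

Lemma near_gap_lt d : 0 < d -> \forall n \near \oo, forall k, (k < 2 ^ n)%N -> gap T n k < d.
Proof.
move=> d0; have [[_ _ Tm] _ _] := T_dyadic.
move/cvgrPdist_lt : Tm => /(_ d d0) H; near=> n => k kn.
have : `|0 - mesh (T n)| < d by near: n; exact: H.
rewrite sub0r normrN; apply: le_lt_trans; apply: le_trans (ler_norm _).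
exact: gap_le_mesh.
Unshelve. all: by end_near. Qed.

Lemma near_increment_lt e : 0 < e ->
  \forall n \near \oo, forall k, (k < 2 ^ n)%N -> `|x (T n)`_k.+1 - x (T n)`_k| < e.
Proof.
move=> e0; have [d d0 dP] := unit_interval_uniform_continuity x_cont e0.
near=> n => k kn; apply: dP; try exact: (partition_itv01 T_dyadic).
  by apply: (partition_itv01 T_dyadic); exact: ltnW.
rewrite -/(gap T n k) gtr0_norm ?gap_gt0 //.
by move: k kn; near: n; exact: near_gap_lt.
Unshelve. all: by end_near. Qed.

Lemma cell_cover n t : 0 <= t <= 1 ->
  exists2 k, (k < 2 ^ n)%N & (T n)`_k <= t <= (T n)`_k.+1.
Proof.
move=> /andP[t0 t1].
suff H N : (0 < N)%N -> (N <= 2 ^ n)%N -> t <= (T n)`_N ->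
    exists2 k, (k < 2 ^ n)%N & (T n)`_k <= t <= (T n)`_k.+1.
  by apply: (H (2 ^ n)%N); rewrite ?expn_gt0 // (partition_last T_dyadic).
elim: N => // -[|N] IH _ Nn tN.
  by exists 0%N => //; rewrite (partition_first T_dyadic) t0.
case: (leP t (T n)`_N.+1) => h; first by apply: IH => //; exact: ltnW.
by exists N.+1 => //; rewrite (ltW h).
Qed.

(** If the variation vanished at all levels, x would be constant on the partition
    points, which are dense because the mesh tends to 0. A positive level is
    requested because the reverse Jensen bounds start there. *)
Lemma variation_gt0 : (exists a b : R, [/\ 0 <= a <= 1, 0 <= b <= 1 & x a <> x b]) ->
  exists2 N, (0 < N)%N & 0 < p_variation T x 1 N.
Proof.
move=> [a [b [a01 b01 xab]]]; apply: contrapT => nV.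
have V0 n : (0 < n)%N -> p_variation T x 1 n = 0.
  move=> n0; apply/eqP; rewrite eq_le p_variation_ge0 andbT leNgt.
  by apply/negP => h; apply: nV; exists n.
have cst n k : (0 < n)%N -> (k <= 2 ^ n)%N -> x (T n)`_k = x 0.
  move=> n0; elim: k => [_|k IH kn]; first by rewrite (partition_first T_dyadic).
  rewrite -IH; last exact: ltnW.
  apply/eqP; rewrite -subr_eq0 -normr_le0 -[leRHS](V0 n n0) /p_variation.
  rewrite (bigD1_seq k) ?mem_index_iota ?iota_uniq //= powRr1 // lerDl.
  by apply: sumr_ge0 => j _; exact: powR_ge0.
suff H t : 0 <= t <= 1 -> x t = x 0 by apply: xab; rewrite !H.
move=> t01; apply/eqP; rewrite -subr_eq0 -normr_le0; apply/ler_addgt0Pr => e e0.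
rewrite add0r.
have [d d0 dP] := unit_interval_uniform_continuity x_cont e0.
near \oo => n; have n0 : (0 < n)%N by near: n; exact: nbhs_infty_gt.
have [k kn /andP[k1 k2]] := cell_cover n t01.
rewrite -(cst n k n0 (ltnW kn)) ltW // dP //.
  by apply: (partition_itv01 T_dyadic); exact: ltnW.
rewrite ger0_norm ?subr_ge0 //.
have : gap T n k < d by move: k kn {k1 k2}; near: n; exact: near_gap_lt.
by apply: le_lt_trans; rewrite /gap lerD2r.
Unshelve. all: by end_near. Qed.

(** For increments d of modulus at most e, |d| <= e^(1 - p) * |d|^p; as the
    variation stays bounded below while e can be taken arbitrarily small, the
    p-variation explodes. *)
Lemma p_variation_lt1_cvgy p N : 0 < p < 1 -> 0 < p_variation T x 1 N ->
  p_variation T x p n @[n --> \oo] --> +oo.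
Proof.
move=> /andP[p0 p1] V0; apply/cvgryPge => C.
set v := p_variation T x 1 N in V0.
pose C' := Num.max C 1.
have C0 : 0 < C' by rewrite lt_max ltr01 orbT.
have q0 : 0 < 1 - p by lra.
(* chosen so that v / e^(1 - p) is the required bound C' *)
pose e := (v / C') `^ (1 - p)^-1.
have e0 : 0 < e by rewrite powR_gt0 // divr_gt0.
have eE : e `^ (1 - p) = v / C'.
  by rewrite /e -powRrM mulVf ?gt_eqF // powRr1 // divr_ge0 // ltW.
near=> n; apply: (@le_trans _ _ C'); first by rewrite le_max lexx.
have Nn : (N <= n)%N by near: n; exact: nbhs_infty_ge.
have inc : forall k, (k < 2 ^ n)%N -> `|x (T n)`_k.+1 - x (T n)`_k| < e.
  by near: n; exact: near_increment_lt.
have : v <= v / C' * p_variation T x p n.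
  apply: le_trans (p_variation1_le Nn) _.
  rewrite -eE /p_variation mulr_sumr !big_nat; apply: ler_sum => k /andP[_ kn].
  have -> : `|x (T n)`_k.+1 - x (T n)`_k| `^ 1 =
      `|x (T n)`_k.+1 - x (T n)`_k| `^ (1 - p) * `|x (T n)`_k.+1 - x (T n)`_k| `^ p.
    by rewrite -powRD subrK // oner_eq0.
  by rewrite ler_wpM2r ?powR_ge0 // powR_le // ltW // inc.
by rewrite mulrAC ler_pdivlMr // ler_pM2l.
Unshelve. all: by end_near. Qed.

Lemma p_variation1_bound : exists2 C : R, 1 <= C &
  forall n, p_variation T x 1 n <= C * 2 ^+ n.
Proof.
have [C C0 CP] := unit_interval_bounded x_cont.
exists (C + 1); first by lra.
move=> n; rewrite -natrX mulr_natr.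
have -> : (C + 1) *+ 2 ^ n = \sum_(0 <= k < 2 ^ n) (C + 1).
  by rewrite sumr_const_nat subn0.
rewrite /p_variation !big_nat; apply: ler_sum => k /andP[_ kn].
rewrite powRr1 //; apply: (@le_trans _ _ C); last lra.
by apply: CP; apply: (partition_itv01 T_dyadic) => //; exact: ltnW.
Qed.

End Variation.

(** * Roughness exponent and limit of the estimator *)

Section GrowthRate.
Variables (R : realType) (v : nat -> R) (g : R).
Hypothesis v_rate : n%:R^-1 * ln (v n) @[n --> \oo] --> g.

Lemma growth_cvgy : 0 < g -> v n @[n --> \oo] --> +oo.
Proof.
move=> g0; apply/cvgryPge => C; have g2 : 0 < g / 2 by rewrite divr_gt0.
have /cvgrPdist_lt/(_ _ g2) H := v_rate.
near=> n; have n0 : (0 < n)%N by near: n; exact: nbhs_infty_gt.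
have nr : 0 < n%:R :> R by rewrite ltr0n.
have hC : C / (g / 2) <= n%:R by near: n; exact: nbhs_infty_ger.
have : `|g - n%:R^-1 * ln (v n)| < g / 2 by near: n; exact: H.
rewrite ltr_norml => /andP[_ h].
have {}h : g / 2 * n%:R < ln (v n).
  by rewrite -ltr_pdivlMr // mulrC; lra.
have l0 : 0 < ln (v n) by apply: lt_trans h; rewrite mulr_gt0.
have v0 : 0 < v n by rewrite ltNge; apply/negP => /ln0 e; rewrite e ltxx in l0.
have := expR_ge1Dx (ln (v n)); rewrite lnK ?posrE //.
rewrite ler_pdivrMr // mulrC in hC; lra.
Unshelve. all: by end_near. Qed.

Lemma growth_cvg0 : g < 0 -> (forall n, 0 <= v n) -> v n @[n --> \oo] --> 0.
Proof.
move=> g0 v_ge0; apply/cvgrPdist_lt => e e0.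
have g2 : 0 < - g / 2 by rewrite divr_gt0 // oppr_gt0.
have /cvgrPdist_lt/(_ _ g2) H := v_rate.
near=> n; have n0 : (0 < n)%N by near: n; exact: nbhs_infty_gt.
have nr : 0 < n%:R :> R by rewrite ltr0n.
have he : - ln e / (- g / 2) <= n%:R by near: n; exact: nbhs_infty_ger.
have : `|g - n%:R^-1 * ln (v n)| < - g / 2 by near: n; exact: H.
rewrite ltr_norml => /andP[h _]; rewrite sub0r normrN ger0_norm //.
have {}h : ln (v n) < g / 2 * n%:R.
  by rewrite -ltr_pdivrMr // mulrC; lra.
have := v_ge0 n; rewrite le_eqVlt => /predU1P[<-//|v0].
rewrite -ltr_ln ?posrE //; apply: lt_le_trans h _.
rewrite ler_pdivrMr // in he; lra.
Unshelve. all: by end_near. Qed.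

End GrowthRate.

Section RoughnessLimit.
Variables (R : realType) (T : nat -> seq R) (x : R -> R).
Hypotheses (T_dyadic : dyadic_refinement T) (T_balanced : well_balanced T)
  (x_jensen : reverse_jensen T (faber_schauder T x))
  (x_cont : {within `[0, 1], continuous x})
  (x_nonconst : exists a b : R, [/\ 0 <= a <= 1, 0 <= b <= 1 & x a <> x b]).

Local Notation pvar := (p_variation T x).

Lemma amplitude_gt0 : exists N, 0 < amplitude T x N.
Proof.
have [N N0 V0] := variation_gt0 T_dyadic x_cont x_nonconst; exists N.
have [K [_ _ KP]] := p_variation_amplitude T_dyadic T_balanced x_jensen (lexx 1).
rewrite lt_neqAle amplitude_ge0 andbT eq_sym; apply/eqP => A0.
have [h _] := KP N N0; move: (lt_le_trans V0 h).
by rewrite A0 powR0 ?oner_eq0 // !mulr0 ltxx.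
Qed.

Lemma growth_rate_Rhat p : 1 <= p ->
  n%:R^-1 * ln (pvar p n) - (1 - p * Rhat T x n) * ln 2 @[n --> \oo] --> (0 : R).
Proof.
by move=> p1; have [N AN] := amplitude_gt0;
  exact: (ln_p_variation_Rhat T_dyadic T_balanced x_jensen p1 AN).
Qed.

Let ln2_gt0 : 0 < ln (2 : R). Proof. by rewrite ln_gt0 // ltr1n. Qed.

(** A p-variation bounded below cannot have a negative growth rate. *)
Lemma Rhat_lt p c e : 1 <= p -> 0 < c -> (\forall n \near \oo, c <= pvar p n) ->
  0 < e -> \forall n \near \oo, p * Rhat T x n < 1 + e.
Proof.
move=> p1 c0 cp e0.
have d0 : 0 < e * ln 2 / 2 by rewrite divr_gt0 // mulr_gt0.
have /cvgrPdist_lt/(_ _ d0) H1 := growth_rate_Rhat p1.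
have /cvgrPdist_lt/(_ _ d0) H2 := cvg_inv_nat_mul (ln c).
near=> n.
have n0 : (0 < n)%N by near: n; exact: nbhs_infty_gt.
have cpn : c <= pvar p n by near: n.
have : `|0 - (n%:R^-1 * ln (pvar p n) - (1 - p * Rhat T x n) * ln 2)| < e * ln 2 / 2.
  by near: n; exact: H1.
have : `|0 - n%:R^-1 * ln c| < e * ln 2 / 2 by near: n; exact: H2.
rewrite !sub0r !normrN !ltr_norml => /andP[h1 _] /andP[_ h2].
have l : n%:R^-1 * ln c <= n%:R^-1 * ln (pvar p n).
  by rewrite ler_wpM2l ?invr_ge0 // ler_ln ?posrE // (lt_le_trans c0).
rewrite -(ltr_pM2r ln2_gt0); lra.
Unshelve. all: by end_near. Qed.

(** Growth of the p-variation of order at most 2^(b n) bounds its rate by b. The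
    case b = 0 serves exponents with vanishing p-variation, the case b = 1 the
    variation itself. *)
Lemma Rhat_gt p b C e : 1 <= p -> 1 <= C ->
  (\forall n \near \oo, pvar p n <= C * 2 ^+ (b * n)) ->
  0 < e -> \forall n \near \oo, 1 - b%:R - e < p * Rhat T x n.
Proof.
move=> p1 C1 pC e0.
have d0 : 0 < e * ln 2 / 2 by rewrite divr_gt0 // mulr_gt0.
have /cvgrPdist_lt/(_ _ d0) H1 := growth_rate_Rhat p1.
have /cvgrPdist_lt/(_ _ d0) H2 := cvg_inv_nat_mul (ln C).
near=> n.
have n0 : (0 < n)%N by near: n; exact: nbhs_infty_gt.
have nr : n%:R != 0 :> R by rewrite pnatr_eq0 -lt0n.
have cpn : pvar p n <= C * 2 ^+ (b * n) by near: n.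
have : `|0 - (n%:R^-1 * ln (pvar p n) - (1 - p * Rhat T x n) * ln 2)| < e * ln 2 / 2.
  by near: n; exact: H1.
have : `|0 - n%:R^-1 * ln C| < e * ln 2 / 2 by near: n; exact: H2.
rewrite !sub0r !normrN !ltr_norml => /andP[_ h1] /andP[h2 _].
have C0 : 0 < C by exact: lt_le_trans C1.
have w0 : (0 : R) < 2 ^+ (b * n) by rewrite exprn_gt0.
have Cw : ln (C * 2 ^+ (b * n)) = ln C + b%:R * (n%:R * ln 2).
  by rewrite lnM ?posrE // lnXn // -[ln 2 *+ _]mulr_natl natrM mulrA.
have l : ln (pvar p n) <= ln C + b%:R * (n%:R * ln 2).
  rewrite -Cw; have := p_variation_ge0 T x p n; rewrite le_eqVlt => /predU1P[<-|v0].
    rewrite ln0 // ln_ge0 // mulr_ege1 // exprn_ege1 //; lra.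
  by rewrite ler_ln ?posrE // mulr_gt0.
have : n%:R^-1 * ln (pvar p n) <= n%:R^-1 * ln C + b%:R * ln 2.
  have -> : n%:R^-1 * ln C + b%:R * ln 2 = n%:R^-1 * (ln C + b%:R * (n%:R * ln 2)).
    by field.
  by rewrite ler_wpM2l ?invr_ge0.
move=> h3; rewrite -(ltr_pM2r ln2_gt0) !mulrBl mul1r; lra.
Unshelve. all: by end_near. Qed.

(** The variation is nondecreasing in n and eventually positive. *)
Lemma Rhat_lt1 e : 0 < e -> \forall n \near \oo, Rhat T x n < 1 + e.
Proof.
move=> e0; have [N N0 V0] := variation_gt0 T_dyadic x_cont x_nonconst.
have : \forall n \near \oo, pvar 1 N <= pvar 1 n.
  by near=> n; apply: p_variation1_le => //; near: n; exact: nbhs_infty_ge.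
move/(Rhat_lt (lexx 1) V0) => /(_ _ e0); apply: filterS => n.
by rewrite mul1r.
Unshelve. all: by end_near. Qed.

(** Each of the 2^n increments is bounded by the oscillation of x. *)
Lemma Rhat_gt0 e : 0 < e -> \forall n \near \oo, - e < Rhat T x n.
Proof.
move=> e0; have [C C1 CP] := p_variation1_bound T_dyadic x_cont.
have : \forall n \near \oo, pvar 1 n <= C * 2 ^+ (1 * n).
  by near=> n; rewrite mul1n.
move/(Rhat_gt (lexx 1) C1) => /(_ _ e0); apply: filterS => n.
by rewrite mul1r subrr sub0r.
Unshelve. all: by end_near. Qed.

(** Comparing p * rho with 1 instead of p with q = 1 / rho treats the case q = +oo
    together with finite q. *)
Lemma roughness_exponentP rho : roughness_exponent T x rho <->
  [/\ 0 <= rho <= 1,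
      forall p, 1 < p * rho -> 0 < p -> pvar p n @[n --> \oo] --> 0 &
      forall p, p * rho < 1 -> 0 < p -> pvar p n @[n --> \oo] --> +oo].
Proof.
split=> [[q [q1 rq h1 h2]]|[/andP[rho0 rho1] h1 h2]].
  case: q q1 rq h1 h2 => [q| |] //= q1 rq h1 h2.
    rewrite lee_fin in q1; have q0 : 0 < q by exact: lt_le_trans q1.
    rewrite inver (gt_eqF q0) in rq; case: rq => ->; split.
    - by rewrite invr_ge0 ltW //= invf_le1.
    - by move=> p; rewrite ltr_pdivlMr // mul1r => pq p0; apply: h1; rewrite ?lte_fin.
    - by move=> p; rewrite ltr_pdivrMr // mul1r => pq p0; apply: h2; rewrite ?lte_fin.
  rewrite invey in rq; case: rq => ->; split; first by rewrite lexx ler01.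
    by move=> p; rewrite mulr0 ltr10.
  by move=> p _ p0; apply: h2; rewrite ?ltry.
exists (rho%:E^-1)%E; rewrite inveK; case: (eqVneq rho 0) => [rho00|rhon].
  rewrite rho00 inve0; split; [exact: leey|by []|by move=> p _; rewrite ltNge leey|].
  by move=> p p0 _; apply: h2; rewrite // rho00 mulr0.
have r0 : 0 < rho by rewrite lt_neqAle eq_sym rhon.
rewrite inver (negPf rhon); split => //.
- by rewrite lee_fin invf_ge1.
- move=> p p0; rewrite lte_fin => h; apply: h1 => //.
  by rewrite -ltr_pdivrMr // div1r.
- move=> p p0; rewrite lte_fin => h; apply: h2 => //.
  by rewrite -ltr_pdivlMr // div1r.
Qed.

(** Upper bounds on Rhat come from exponents p = 1 / u slightly below q, where the
    p-variation is large, and lower bounds from exponents slightly above q, where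
    it is small; the boundary values rho = 1 and rho = 0, which leave no room on
    one side, are covered by [Rhat_lt1] and [Rhat_gt0]. *)
Lemma Rhat_cvg_roughness rho : roughness_exponent T x rho ->
  Rhat T x n @[n --> \oo] --> rho.
Proof.
move=> /roughness_exponentP[/andP[rho0 rho1] h0 hy].
apply/cvgrPdist_lt => e e0.
have up : \forall n \near \oo, Rhat T x n < rho + e.
  case: (leP 1 rho) => [r1|r1].
    by have := Rhat_lt1 e0; apply: filterS => n; lra.
  pose u := rho + Num.min (e / 2) (1 - rho).
  have u1 : u <= 1 by rewrite /u addrC -lerBrDr ge_min lexx orbT.
  have ue : u <= rho + e / 2 by rewrite /u lerD2l ge_min lexx.
  have ru : rho < u by rewrite /u ltrDl lt_min; apply/andP; split; lra.
  have u0 : 0 < u by exact: le_lt_trans ru.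
  have p1 : 1 <= u^-1 by rewrite invf_ge1.
  have pv : \forall n \near \oo, 1 <= pvar u^-1 n.
    have /cvgryPge : pvar u^-1 n @[n --> \oo] --> +oo.
      by apply: hy; rewrite ?invr_gt0 // mulrC ltr_pdivrMr // mul1r.
    exact.
  have e2 : 0 < e / 2 by rewrite divr_gt0.
  have := Rhat_lt p1 ltr01 pv e2; apply: filterS => n.
  rewrite [u^-1 * _]mulrC ltr_pdivrMr // mulrDl mul1r => h.
  have : e / 2 * u <= e / 2 by rewrite ler_piMr // ltW.
  lra.
have dn : \forall n \near \oo, rho - e < Rhat T x n.
  case: (leP rho 0) => [r0|r0].
    by have := Rhat_gt0 e0; apply: filterS => n; lra.
  pose m := Num.min (e / 2) (rho / 2); pose u := rho - m.
  have m1 : m <= e / 2 by rewrite ge_min lexx.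
  have m2 : m <= rho / 2 by rewrite ge_min lexx orbT.
  have m0 : 0 < m by rewrite lt_min; apply/andP; split; lra.
  have u0 : 0 < u by rewrite /u; lra.
  have u1 : u <= 1 by rewrite /u; lra.
  have p1 : 1 <= u^-1 by rewrite invf_ge1.
  have pv : \forall n \near \oo, pvar u^-1 n <= 1 * 2 ^+ (0 * n).
    have /cvgrPdist_lt/(_ _ ltr01) : pvar u^-1 n @[n --> \oo] --> 0.
      apply: h0; rewrite ?invr_gt0 // mulrC ltr_pdivlMr // mul1r /u; lra.
    apply: filterS => n; rewrite sub0r normrN mul0n expr0 mulr1 => h.
    exact: le_trans (ler_norm _) (ltW h).
  have e2 : 0 < e / 2 by rewrite divr_gt0.
  have := Rhat_gt p1 (lexx 1) pv e2; apply: filterS => n.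
  rewrite subr0 [u^-1 * _]mulrC ltr_pdivlMr // mulrBl mul1r => h.
  have : e / 2 * u <= e / 2 by rewrite ler_piMr // ltW.
  rewrite /u in h *; lra.
near=> n; rewrite distrC ltr_distl; apply/andP; split; near: n; [exact: dn|exact: up].
Unshelve. all: by end_near. Qed.

(** For p >= 1 the growth rate of the p-variation tends to (1 - p * r) * ln 2, whose
    sign decides between 0 and +oo. *)
Lemma roughness_of_Rhat_cvg r : Rhat T x n @[n --> \oo] --> r ->
  roughness_exponent T x r.
Proof.
move=> Rr.
have near_r e : 0 < e -> \forall n \near \oo, `|r - Rhat T x n| < e.
  by move=> e0; have /cvgrPdist_lt := Rr; apply.
have r1 : r <= 1.
  apply/ler_addgt0Pr => e e0; have e2 : 0 < e / 2 by rewrite divr_gt0.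
  near \oo => n.
  have : `|r - Rhat T x n| < e / 2 by near: n; exact: near_r.
  have : Rhat T x n < 1 + e / 2 by near: n; exact: Rhat_lt1.
  rewrite ltr_norml => h /andP[_ h']; lra.
have r0 : 0 <= r.
  apply/ler_addgt0Pr => e e0; have e2 : 0 < e / 2 by rewrite divr_gt0.
  near \oo => n.
  have : `|r - Rhat T x n| < e / 2 by near: n; exact: near_r.
  have : - (e / 2) < Rhat T x n by near: n; exact: Rhat_gt0.
  rewrite ltr_norml => h /andP[h' _]; lra.
have rate p : 1 <= p ->
    n%:R^-1 * ln (pvar p n) @[n --> \oo] --> (1 - p * r) * ln 2.
  move=> p1; rewrite -[X in _ --> X]add0r.
  have h : (1 - p * Rhat T x n) * ln 2 @[n --> \oo] --> (1 - p * r) * ln 2.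
    by apply: cvgM (cvg_cst _); apply: cvgB (cvg_cst _) (cvgM (cvg_cst _) Rr).
  apply: cvg_trans (cvgD (growth_rate_Rhat p1) h); apply: near_eq_cvg; near=> n.
  by rewrite /= subrK.
apply/roughness_exponentP; split; first by rewrite r0 r1.
- move=> p pr p0.
  have p1 : 1 <= p.
    by apply: ltW; apply: lt_le_trans pr _; rewrite ler_piMr // ltW.
  apply: (growth_cvg0 (rate p p1)); last by move=> n; exact: p_variation_ge0.
  by rewrite pmulr_llt0 // subr_lt0.
- move=> p pr p0; case: (ltP p 1) => p1.
    have [N N0 V0] := variation_gt0 T_dyadic x_cont x_nonconst.
    by apply: p_variation_lt1_cvgy V0 => //; rewrite p0.
  by apply: (growth_cvgy (rate p p1)); rewrite mulr_gt0 // subr_gt0.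
Unshelve. all: by end_near. Qed.

End RoughnessLimit.

Theorem theorem9p2 (R : realType) (T : nat -> seq R) (x : R -> R)
  (T_refining : refining T)
  (T_init : T 0%N = [:: 0; 1])
  (T_new : one_new_point T)
  (x_cont : {within `[0, 1], continuous x})
  (x_nonconst : exists a b : R, [/\ 0 <= a <= 1, 0 <= b <= 1 & x a <> x b])
  (x_jensen : reverse_jensen T (faber_schauder T x))
  (T_balanced : well_balanced T) :
  ((exists rho : R, roughness_exponent T x rho) <->
   (exists r : R, Rhat T x n @[n --> \oo] --> r)) /\
  (forall rho r : R, roughness_exponent T x rho ->
     Rhat T x n @[n --> \oo] --> r -> rho = r).
Proof.
have T_dyadic : dyadic_refinement T by split.
have to_limit rho : roughness_exponent T x rho -> Rhat T x n @[n --> \oo] --> rho.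
  exact: Rhat_cvg_roughness.
split; last first.
  by move=> rho r /to_limit h1 h2; exact: cvg_unique h1 h2.
split=> [[rho /to_limit h]|[r h]]; first by exists rho.
by exists r; exact: roughness_of_Rhat_cvg.
Qed.
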